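(* Let $S,\Sigma\subset\mathbb{R}$ be measurable, let $v_0\in L^2(\mathbb{R})$ be such that $\widehat{v_0}$ is supported in $\Sigma$, and let $v$ be the solution of the free Schrödinger equation $$ i\partial_t v+\frac{1}{4\pi}\partial_x^2 v=0,\qquad v(x,0)=v_0(x). $$ (1) If $(S,\Sigma)$ is an annihilating pair and, for some $t>0$, $v(\cdot,t)$ is supported in $S$, then $v_0=0$. (2) If $(S,\Sigma)$ is a strong annihilating pair with constant $D(S,\Sigma)$, then, for all $t>0$, $$ \|v(\cdot,t)\|_{L^2(\mathbb{R}\setminus S)}\geq D(S,\Sigma)\,\|v(\cdot,t)\|_{L^2(\mathbb{R})}=D(S,\Sigma)\,\|v_0\|_{L^2(\mathbb{R})}. $$ (3) There is an absolute constant $C>0$ such that, if $\Sigma=[-1,1]$ and $E\subset\mathbb{R}$ is $\gamma$-thick at scale $a>1$, then for all $t>0$, $$ \|v(\cdot,t)\|_{L^2(E)}\geq\left(\frac{\gamma}{C}\right)^{Ca}\|v_0\|_{L^2(\mathbb{R})}. $$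
   Context: The Fourier transform is $\widehat{f}(\xi)=\int_{\mathbb{R}} f(x)e^{-2i\pi x\xi}\,dx$, extended to $L^2(\mathbb{R})$ as usual. The solution of the free Schrödinger equation with initial data $v_0\in L^2(\mathbb{R})$ is $v(x,t)=\int_{\mathbb{R}}e^{-i\pi\xi^2t+2i\pi x\xi}\widehat{v_0}(\xi)\,d\xi$, i.e. $v(\cdot,t)$ is the inverse Fourier transform of $\xi\mapsto e^{-i\pi\xi^2t}\widehat{v_0}(\xi)$ in $L^2(\mathbb{R})$. ''Supported in $S$'' means vanishing almost everywhere outside $S$. For measurable $S,\Sigma\subset\mathbb{R}$, $(S,\Sigma)$ is a (weak) annihilating pair if every $f\in L^2(\mathbb{R})$ with $f$ supported in $S$ and $\widehat f$ supported in $\Sigma$ is $0$. It is a strong annihilating pair if there is a constant $C(S,\Sigma)$ such that $\|f\|_{L^2(\mathbb{R})}\leq C(S,\Sigma)\bigl(\|f\|_{L^2(\mathbb{R}\setminus S)}+\|\widehat{f}\|_{L^2(\mathbb{R}\setminus\Sigma)}\bigr)$ for all $f\in L^2(\mathbb{R})$; equivalently, there is a constant $D(S,\Sigma)>0$ such that $\|f\|_{L^2(\mathbb{R}\setminus S)}\geq D(S,\Sigma)\|f\|_{L^2(\mathbb{R})}$ for all $f\in L^2(\mathbb{R})$ with $\widehat f$ supported in $\Sigma$. ''With constant $D(S,\Sigma)$'' refers to the constant in this last inequality. A measurable set $E\subset\mathbb{R}$ is $\gamma$-thick at scale $a>1$ (with $\gamma>0$) if $|E\cap[x-a,x+a]|\geq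 2\gamma a$ for all $x\in\mathbb{R}$, where $|\cdot|$ is Lebesgue measure. *)

(* Defs.v *)
From HB Require Import structures.
From mathcomp Require Import all_boot all_order all_algebra.
From mathcomp Require Import all_classical all_reals all_analysis.
From mathcomp Require Import measurable_realfun complex.

Set Implicit Arguments.
Unset Strict Implicit.
Unset Printing Implicit Defensive.

Import Order.TTheory GRing.Theory Num.Theory.
Import numFieldNormedType.Exports.

Local Open Scope classical_set_scope.
Local Open Scope ring_scope.

(* Elements of L^p(R) are represented by Borel functions R -> R[i]; every class
   has such a representative. The statements below quantify over all of them. *)

Section ComplexL2.
Context {R : realType}.
Local Notation mu := (@lebesgue_measure R).
Local Notation re := (@complex.Re R).
Local Notation im := (@complex.Im R).
Implicit Types (f g : R -> R[i]) (A E S : set R).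

(* Borel sets up to null sets; by [g_sigma_completed_algebra_genE] and
   [completed_caratheodory_measurable] these are Caratheodory's measurable
   sets. *)
Definition lebesgue_measurable A : Prop := completed_algebra_gen mu A.

Definition inLp (p : \bar R) f : Prop :=
  (re \o f \in Lfun mu p) /\ (im \o f \in Lfun mu p).

(* The norm of L^2(A). When A is only Lebesgue measurable the integrand need
   not be Borel; its integral, a supremum over Borel simple functions below it,
   is still the Lebesgue integral. *)
Definition L2norm A f : \bar R :=
  Lnorm mu 2%:E ((fun x => (Normc.normc (f x))%:E) \_ A).

Definition supported_in A f : Prop := {ae mu, forall x, ~ A x -> f x = 0}.

Definition cintegral f : R[i] :=
  Complex (\int[mu]_x re (f x)) (\int[mu]_x im (f x)).

Definition cis (theta : R) : R[i] := Complex (cos theta) (sin theta).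

Definition fourier_integral f (xi : R) : R[i] :=
  cintegral (fun x => f x * cis (- (2 * pi * x * xi))).

Definition inv_fourier_integral f (x : R) : R[i] :=
  cintegral (fun xi => f xi * cis (2 * pi * x * xi)).

(* The graph of the extension to L^2 of an operator T given on the dense
   subspace L^1 `&` L^2: the L^2-closure of the graph of T on that subspace. *)
Definition L2_extension (T : (R -> R[i]) -> R -> R[i]) f g : Prop :=
  [/\ inLp 2%:E f, inLp 2%:E g &
      exists u : nat -> R -> R[i],
        [/\ forall n, inLp 1%:E (u n) /\ inLp 2%:E (u n),
            (fun n => L2norm setT (u n \- f)) @ \oo --> 0%E &
            (fun n => L2norm setT (T (u n) \- g)) @ \oo --> 0%E]].

(* [g] is the Fourier (resp. inverse Fourier) transform of [f] in L^2; by
   Plancherel's theorem such a [g] exists for every [f] in L^2 and is unique up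
   to a null set. *)
Definition is_fourier f g : Prop := L2_extension fourier_integral f g.

Definition is_inv_fourier f g : Prop := L2_extension inv_fourier_integral f g.

(* [v t] is the solution at time [t], as an element of L^2. *)
Definition schrodinger_solution (v0 : R -> R[i]) (v : R -> R -> R[i]) : Prop :=
  exists2 w0 : R -> R[i], is_fourier v0 w0 &
    forall t : R,
      is_inv_fourier (fun xi => cis (- (pi * xi ^+ 2 * t)) * w0 xi) (v t).

Definition annihilating_pair S Sigma : Prop :=
  forall f g, is_fourier f g -> supported_in S f -> supported_in Sigma g ->
    {ae mu, forall x, f x = 0}.

Definition strong_annihilating_pair_with S Sigma (D : R) : Prop :=
  0 < D /\
  forall f g, is_fourier f g -> supported_in Sigma g ->
    (D%:E * L2norm setT f <= L2norm (~` S) f)%E.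

Definition thick (gamma a : R) E : Prop :=
  forall x : R, ((2 * gamma * a)%:E <= mu (E `&` `[(x - a)%R, (x + a)%R]%classic))%E.

End ComplexL2.

(* Main.v *)
(** The phase [e^(-i pi xi^2 t)] has modulus one, so [v(., t)] and [v_0] have
    Fourier transforms with the same support and the same modulus. Hence (1) and
    (2) follow from Plancherel's theorem by taking [f = v(., t)] in the
    definitions of annihilating pairs, and (3) is the Logvinenko-Sereda
    inequality for functions [f] with spectrum in [[-1, 1]].

    Plancherel's theorem comes from Abel summation: [e^(-e |xi|)] is the Fourier
    transform of the Poisson kernel [P_e], so the integral of
    [e^(-e |xi|) |a^(xi)|^2] equals that of [a (a * P_e)]; let [e] tend to [0],
    first for [a] continuous, bounded and integrable, then by density.

    For Logvinenko-Sereda, cut the line into intervals [I] of length [L = 2 a].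
    By Markov's inequality [f^2] is at most about twice its mean over [E `&` I]
    on a subset of measure at least [gamma L / 2], which contains [N] points with
    gaps at least [gamma L / (4 N)]. Lagrange interpolation at these points
    controls [f] on [I], up to [L^N / N!] times the supremum of the [N]-th
    derivative. With [N] close to [128 a], Bernstein's inequality
    [||f^(N)|| <= 8^N ||f||] makes the total error at most half of [||f||^2], and
    the loss is a factor [(32 / gamma)^N]. *)

Require Import Defs.
From HB Require Import structures.
From mathcomp Require Import all_boot all_order all_algebra.
From mathcomp Require Import all_classical all_reals all_analysis.
From mathcomp Require Import measurable_realfun complex.
From mathcomp Require Import ring lra.

Set Implicit Arguments.
Unset Strict Implicit.
Unset Printing Implicit Defensive.

Import Order.TTheory GRing.Theory Num.Theory.
Import numFieldNormedType.Exports.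

Local Open Scope classical_set_scope.
Local Open Scope ring_scope.

(** * The real Hilbert space of square-integrable complex functions *)

Section ComplexL2Space.
Context {R : realType}.
Local Notation mu := (@lebesgue_measure R).
Local Notation re := (@complex.Re R).
Local Notation im := (@complex.Im R).
Implicit Types (f g h : R -> R[i]) (a b c k : R -> R).

(** Only moduli and real parts of inner products enter, so L2 is treated as a real Hilbert space,
    and transforms are split into cosine and sine transforms of real functions. A sign [s] with
    [s ^+ 2 = 1] covers the Fourier integral and its inverse in one argument; invertibility follows
    from isometry and adjointness, without an inversion theorem.

    For (3) the obstacle is that a high derivative may be large on an individual interval. The local
    inequality therefore keeps the derivative term as an integral over that same interval: both
    sides add up over the intervals, and Bernstein's inequality enters only after summation. No
    selection of good intervals is made.

    The exponent is linear in [a] because the error [(8 L)^N / N!] becomes small once [N] is a large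
    multiple of [L], while the interpolation norm is exponential in [N]. With [L = 2 a] the
    requirement [64 L <= N] reads [128 a <= N], and rounding to an integer costs at most [a] since
    [a > 1]; hence the constant [129]. *)

Definition cdot (z w : R[i]) : R := re z * re w + im z * im w.

Definition itg a : Prop := mu.-integrable setT (EFin \o a).

Lemma itg_measurable a : itg a -> measurable_fun setT a.
Proof. by move=> /measurable_int /measurable_EFinP. Qed.

Lemma itgD a b : itg a -> itg b -> itg (fun x => a x + b x).
Proof. exact: integrableD. Qed.

Lemma itgB a b : itg a -> itg b -> itg (fun x => a x - b x).
Proof. exact: integrableB. Qed.

Lemma itgZ r a : itg a -> itg (fun x => r * a x).
Proof. exact: integrableZl. Qed.

Lemma itg_le a b : measurable_fun setT a -> itg b -> (forall x, `|a x| <= b x) -> itg a.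
Proof.
move=> ma ib ab; apply: le_integrable ib => //; first exact/measurable_EFinP.
by move=> x _ /=; rewrite lee_fin; exact: le_trans (ab x) (ler_norm _).
Qed.

Lemma itg_abs a : itg a -> itg (fun x => `|a x|).
Proof. exact: integrable_abse. Qed.

Lemma itgM a k (M : R) : itg a -> measurable_fun setT k -> (forall x, `|k x| <= M) ->
  itg (fun x => a x * k x).
Proof.
move=> ia mk kM; apply: (@itg_le _ (fun x => M * `|a x|)).
- by apply: measurable_funM => //; exact: itg_measurable.
- exact/itgZ/itg_abs.
- by move=> x; rewrite normrM mulrC ler_wpM2r.
Qed.

Lemma RitgD a b : itg a -> itg b -> \int[mu]_x (a x + b x) = \int[mu]_x a x + \int[mu]_x b x.
Proof. exact: RintegralD. Qed.

Lemma RitgB a b : itg a -> itg b -> \int[mu]_x (a x - b x) = \int[mu]_x a x - \int[mu]_x b x.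
Proof. exact: RintegralB. Qed.

Lemma RitgZ r a : itg a -> \int[mu]_x (r * a x) = r * \int[mu]_x a x.
Proof. exact: RintegralZl. Qed.

Lemma Ritg_le a b : itg a -> itg b -> (forall x, a x <= b x) ->
  \int[mu]_x a x <= \int[mu]_x b x.
Proof. by move=> ia ib ab; apply: le_Rintegral. Qed.

Lemma EFin_Ritg a : itg a -> (\int[mu]_x a x)%:E = (\int[mu]_x (a x)%:E)%E.
Proof. by move=> ia; rewrite /Rintegral fineK //; exact: integrable_fin_num ia. Qed.

Lemma ae_imply (P Q : R -> Prop) : (forall x, P x -> Q x) ->
  {ae mu, forall x, P x} -> {ae mu, forall x, Q x}.
Proof.
by move=> PQ; apply: negligibleS => x /= nQ Px; apply: nQ; exact: PQ.
Qed.

Lemma reB z w : re (z - w) = re z - re w.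
Proof. by case: z; case: w. Qed.
Lemma imB z w : im (z - w) = im z - im w.
Proof. by case: z; case: w. Qed.

Lemma cdotC z w : cdot z w = cdot w z.
Proof. by rewrite /cdot mulrC [im z * _]mulrC. Qed.

Lemma cdot_ge0 z : 0 <= cdot z z.
Proof. by rewrite /cdot -!expr2 addr_ge0 // sqr_ge0. Qed.

Lemma cdot_eq0 z : cdot z z = 0 -> z = 0.
Proof.
rewrite /cdot; move/eqP; rewrite -!expr2 paddr_eq0 ?sqr_ge0 // !sqrf_eq0.
by case: z => x y /= /andP[/eqP -> /eqP ->].
Qed.

Lemma normc_sqr (z : R[i]) : (Normc.normc z) ^+ 2 = cdot z z.
Proof. by case: z => x y /=; rewrite /cdot sqr_sqrtr ?addr_ge0 ?sqr_ge0 // !expr2. Qed.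

Lemma Lfun2I a : measurable_fun setT a -> (\int[mu]_x ((a x) ^+ 2)%:E < +oo)%E ->
  a \in Lfun mu 2%:E.
Proof.
move=> ma ioo; rewrite inE; apply/andP; split; rewrite inE/= //.
rewrite /finite_norm unlock poweR_lty//=.
rewrite (_ : (\int[mu]_x _)%E = (\int[mu]_x ((a x) ^+ 2)%:E)%E) //.
by apply: eq_integral => x _; rewrite powR_mulrn// real_normK// num_real.
Qed.

Lemma inLp2I f : measurable_fun setT (re \o f) -> measurable_fun setT (im \o f) ->
  (\int[mu]_x (cdot (f x) (f x))%:E < +oo)%E -> inLp 2%:E f.
Proof.
move=> mr mi ioo.
have md : measurable_fun setT (fun x => cdot (f x) (f x)).
  by apply: measurable_funD; apply: measurable_funM.
split; apply: Lfun2I => //; apply: le_lt_trans ioo; apply: ge0_le_integral => //.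
- by move=> x _; rewrite lee_fin sqr_ge0.
- by apply/measurable_EFinP; exact: measurable_funX.
- by apply/measurable_EFinP.
- by move=> x _; rewrite lee_fin /cdot -!expr2 /= lerDl sqr_ge0.
- by move=> x _; rewrite lee_fin sqr_ge0.
- by apply/measurable_EFinP; exact: measurable_funX.
- by apply/measurable_EFinP.
- by move=> x _; rewrite lee_fin /cdot -!expr2 /= lerDr sqr_ge0.
Qed.

Lemma inLp_measurable p f : inLp p f ->
  measurable_fun setT (re \o f) /\ measurable_fun setT (im \o f).
Proof.
by case=> /sub_Lfun_mfun + /sub_Lfun_mfun; rewrite !inE.
Qed.

Lemma inLp1P f : inLp 1%:E f <-> itg (re \o f) /\ itg (im \o f).
Proof. by split=> -[/Lfun1_integrable ? /Lfun1_integrable ?]. Qed.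

Lemma integrable_cdot f g : inLp 2%:E f -> inLp 2%:E g ->
  itg (fun x => cdot (f x) (g x)).
Proof.
move=> [f1 f2] [g1 g2].
by apply: (@itgD ((re \o f) \* (re \o g)) ((im \o f) \* (im \o g)));
  apply/Lfun1_integrable; apply: Lfun2_mul_Lfun1.
Qed.

Definition ip f g : R := \int[mu]_x cdot (f x) (g x).
Definition nrm f : R := Num.sqrt (ip f f).

Lemma EFin_ip f g : inLp 2%:E f -> inLp 2%:E g ->
  (ip f g)%:E = (\int[mu]_x (cdot (f x) (g x))%:E)%E.
Proof.
by move=> f2 g2; rewrite /ip /Rintegral fineK //; apply: integrable_fin_num (integrable_cdot f2 g2).
Qed.

Lemma ipC f g : ip f g = ip g f.
Proof. by apply: eq_Rintegral => x _; rewrite cdotC. Qed.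

Lemma ip_ge0 f : 0 <= ip f f.
Proof. by apply: Rintegral_ge0 => x _; exact: cdot_ge0. Qed.

Lemma nrm_ge0 f : 0 <= nrm f. Proof. exact: sqrtr_ge0. Qed.

Lemma nrm_sqr f : nrm f ^+ 2 = ip f f.
Proof. by rewrite sqr_sqrtr // ip_ge0. Qed.

Lemma inLp2B f g : inLp 2%:E f -> inLp 2%:E g -> inLp 2%:E (f \- g).
Proof.
move=> f2 g2; have [mf1 mf2] := inLp_measurable f2; have [mg1 mg2] := inLp_measurable g2.
have mr : measurable_fun setT (re \o (f \- g)).
  by rewrite (_ : _ \o _ = (re \o f) \- (re \o g)); [exact: measurable_funB|apply/funext => x /=; rewrite reB].
have mi : measurable_fun setT (im \o (f \- g)).
  by rewrite (_ : _ \o _ = (im \o f) \- (im \o g)); [exact: measurable_funB|apply/funext => x /=; rewrite imB].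
apply: inLp2I => //.
have /integrableP[_] := integrableD measurableT (integrableZl measurableT 2 (integrable_cdot f2 f2)) (integrableZl measurableT 2 (integrable_cdot g2 g2)).
apply: le_lt_trans; apply: ge0_le_integral => //.
- by move=> x _; rewrite lee_fin cdot_ge0.
- by apply/measurable_EFinP; apply: measurable_funD; apply: measurable_funM.
- apply: measurableT_comp => //; apply: emeasurable_funD; apply: measurable_funeM; apply/measurable_EFinP;
  by apply: measurable_funD; apply: measurable_funM.
- move=> x _ /=; rewrite lee_fin; apply: le_trans (ler_norm _).
  rewrite /cdot reB imB.
  (* Gives [|z - w|^2 <= 2 |z|^2 + 2 |w|^2]. *)
  have := sqr_ge0 (re (f x) + re (g x)); have := sqr_ge0 (im (f x) + im (g x)).
  by rewrite !expr2; nra.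
Qed.

Lemma ipBl f g h : inLp 2%:E f -> inLp 2%:E g -> inLp 2%:E h ->
  ip (f \- g) h = ip f h - ip g h.
Proof.
move=> f2 g2 h2; rewrite /ip -RintegralB //; [|exact: integrable_cdot..].
by apply: eq_Rintegral => x _; rewrite /cdot reB imB; ring.
Qed.

Lemma ipBr f g h : inLp 2%:E f -> inLp 2%:E g -> inLp 2%:E h ->
  ip h (f \- g) = ip h f - ip h g.
Proof. by move=> f2 g2 h2; rewrite ipC ipBl // !(ipC h). Qed.

Lemma ipBB f g : inLp 2%:E f -> inLp 2%:E g ->
  ip (f \- g) (f \- g) = ip f f - 2 * ip f g + ip g g.
Proof.
move=> f2 g2; rewrite ipBl //; last exact: inLp2B.
by rewrite !ipBr // (ipC g f); ring.
Qed.

(** The integral of [|f + s g|^2] is a nonnegative polynomial of degree at most two in the real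
    variable [s]. *)
Lemma cauchy_schwarz f g : inLp 2%:E f -> inLp 2%:E g ->
  `|ip f g| <= nrm f * nrm g.
Proof.
move=> f2 g2.
have fg := integrable_cdot f2 g2; have ff := integrable_cdot f2 f2; have gg := integrable_cdot g2 g2.
have H s : 0 <= ip f f + s * (2 * ip f g) + s ^+ 2 * ip g g.
  rewrite /ip; have <- : \int[mu]_x (cdot (f x) (f x) + s * (2 * cdot (f x) (g x)) + s ^+ 2 * cdot (g x) (g x))
     = \int[mu]_x cdot (f x) (f x) + s * (2 * \int[mu]_x cdot (f x) (g x)) + s ^+ 2 * \int[mu]_x cdot (g x) (g x).
    have i1 := itgZ 2 fg; have i2 := itgZ s i1; have i3 := itgZ (s ^+ 2) gg.
    by rewrite (RitgD (itgD ff i2) i3) (RitgD ff i2) !RitgZ.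
  apply: Rintegral_ge0 => x _; rewrite /cdot.
  have := sqr_ge0 (re (f x) + s * re (g x)); have := sqr_ge0 (im (f x) + s * im (g x)).
  by rewrite !expr2; nra.
rewrite -(@ler_pXn2r _ 2) // ?nnegrE ?mulr_ge0 ?nrm_ge0 // exprMn !nrm_sqr real_normK ?num_real //.
have [g0|g0] := eqVneq (ip g g) 0.
  rewrite g0 mulr0; have [->|I0] := eqVneq (ip f g) 0; first by rewrite expr0n.
  (* With [ip g g = 0] the polynomial is affine, and this [s] would give it the value
     [- ip f f - 2]. *)
  have := H (- (ip f f + 1) / ip f g); rewrite g0 mulr0 addr0.
  have -> : - (ip f f + 1) / ip f g * (2 * ip f g) = - (ip f f + 1) * 2 by field.
  by have := ip_ge0 f; lra.
have gp : 0 < ip g g by rewrite lt_def g0 ip_ge0.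
have := H (- ip f g / ip g g).
rewrite -(pmulr_lge0 _ gp).
have -> : (ip f f + - ip f g / ip g g * (2 * ip f g) + (- ip f g / ip g g) ^+ 2 * ip g g) * ip g g
  = ip f f * ip g g - ip f g ^+ 2 by field.
by rewrite subr_ge0.
Qed.

Lemma nrmB f g : inLp 2%:E f -> inLp 2%:E g -> nrm (f \- g) <= nrm f + nrm g.
Proof.
move=> f2 g2; rewrite -(@ler_pXn2r _ 2) // ?nnegrE ?addr_ge0 ?nrm_ge0 // nrm_sqr ipBB //.
have := cauchy_schwarz f2 g2; rewrite ler_norml => /andP[+ _].
by rewrite -!nrm_sqr => ?; nra.
Qed.

Lemma nrm_distC f g : nrm (f \- g) = nrm (g \- f).
Proof. by congr Num.sqrt; apply: eq_Rintegral => x _; rewrite /cdot !reB !imB; ring. Qed.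

Lemma nrm_triangle f g h : inLp 2%:E f -> inLp 2%:E g -> inLp 2%:E h ->
  nrm (f \- h) <= nrm (f \- g) + nrm (g \- h).
Proof.
move=> f2 g2 h2; rewrite (nrm_distC g h).
have -> : f \- h = (f \- g) \- (h \- g) by apply/funext => x /=; ring.
by apply: nrmB; exact: inLp2B.
Qed.

Lemma nrm_dist f g : inLp 2%:E f -> inLp 2%:E g -> `|nrm f - nrm g| <= nrm (f \- g).
Proof.
move=> f2 g2; rewrite ler_norml; apply/andP; split.
  have := nrmB f2 (inLp2B f2 g2).
  have -> : f \- (f \- g) = g by apply/funext => x /=; ring.
  by lra.
have := nrmB g2 (inLp2B g2 f2).
have -> : g \- (g \- f) = f by apply/funext => x /=; ring.
by rewrite (nrm_distC g f); lra.
Qed.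

Lemma nrm_cvg (u : nat -> R -> R[i]) f : (forall n, inLp 2%:E (u n)) -> inLp 2%:E f ->
  nrm (u n \- f) @[n --> \oo] --> (0:R) -> nrm (u n) @[n --> \oo] --> nrm f.
Proof.
move=> u2 f2 cv; apply/subr_cvg0/norm_cvg0P.
apply: squeeze_cvgr (cvg_cst 0) cv; apply: nearW => n.
by rewrite normr_ge0 /= nrm_dist.
Qed.

Lemma ip_cvg (u : nat -> R -> R[i]) f g : (forall n, inLp 2%:E (u n)) -> inLp 2%:E f -> inLp 2%:E g ->
  nrm (u n \- f) @[n --> \oo] --> (0:R) -> ip g (u n) @[n --> \oo] --> ip g f.
Proof.
move=> u2 f2 g2 cv; apply/subr_cvg0/norm_cvg0P.
have cv' : nrm g * nrm (u n \- f) @[n --> \oo] --> (0:R).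
  by rewrite -(mulr0 (nrm g)); apply: cvgMr.
apply: squeeze_cvgr (cvg_cst 0) cv'; apply: nearW => n.
by rewrite normr_ge0 /= -ipBr //; apply: cauchy_schwarz => //; exact: inLp2B.
Qed.

Lemma L2normE (A : set R) f :
  L2norm A f = ((\int[mu]_(x in A) (cdot (f x) (f x))%:E) `^ 2^-1)%E.
Proof.
rewrite /L2norm unlock; congr (_ `^ _)%E; rewrite [RHS]integral_mkcond.
apply: eq_integral => x _; rewrite !patchE; case: ifPn => _ /=.
  by rewrite powR_mulrn // real_normK ?num_real // normc_sqr.
by rewrite normr0 powR0.
Qed.

Lemma L2normT f : inLp 2%:E f -> L2norm setT f = (nrm f)%:E.
Proof. by move=> f2; rewrite L2normE -EFin_ip // poweR_EFin powR12_sqrt // ip_ge0. Qed.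

Lemma ip_eq0_ae f : inLp 2%:E f -> ip f f = 0 -> {ae mu, forall x, f x = 0}.
Proof.
move=> f2 f0.
have [mf1 mf2] := inLp_measurable f2.
have : ae_eq mu setT (EFin \o (fun x => cdot (f x) (f x))) (cst 0%E).
  apply/ae_eq_integral_abs => //.
    by apply/measurable_EFinP; apply: measurable_funD; apply: measurable_funM.
  rewrite -[RHS]/(0%R)%:E -f0 EFin_ip //; apply: eq_integral => x _ /=.
  by rewrite ger0_norm // cdot_ge0.
apply: filterS => x /(_ I) /= [] /cdot_eq0 //.
Qed.

Lemma nrm_eq0_ae f : inLp 2%:E f -> nrm f = 0 -> {ae mu, forall x, f x = 0}.
Proof. by move=> f2 f0; apply: ip_eq0_ae => //; rewrite -nrm_sqr f0 expr0n. Qed.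

Lemma eq_ip_ae f g h : inLp 2%:E f -> inLp 2%:E g -> inLp 2%:E h ->
  {ae mu, forall x, f x = g x} -> ip h f = ip h g.
Proof.
move=> f2 g2 h2 fg; congr fine; apply: ae_eq_integral => //.
- by case/integrableP: (integrable_cdot h2 f2).
- by case/integrableP: (integrable_cdot h2 g2).
- by apply: ae_imply fg => x -> _.
Qed.

Lemma nrm_ae f g : inLp 2%:E f -> inLp 2%:E g ->
  {ae mu, forall x, f x = g x} -> nrm f = nrm g.
Proof.
by move=> f2 g2 fg; rewrite /nrm (eq_ip_ae _ _ _ fg) // ipC (eq_ip_ae _ _ _ fg).
Qed.

End ComplexL2Space.

(** * Plancherel's theorem *)

Section RealTransforms.
Context {R : realType}.
Local Notation mu := (@lebesgue_measure R).
Implicit Types (a b c p q : R -> R).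

Lemma itg_Fubini p q (k : R * R -> R) (M : R) : itg p -> itg q ->
  measurable_fun setT k -> (forall z, `|k z| <= M) ->
  \int[mu]_x (p x * \int[mu]_y (q y * k (x, y))) =
  \int[mu]_y (q y * \int[mu]_x (p x * k (x, y))).
Proof.
move=> ip iq mk kM.
have mp := itg_measurable ip; have mq := itg_measurable iq.
have mkx x : measurable_fun setT (fun y => k (x, y)) by exact: measurableT_comp.
have mky y : measurable_fun setT (fun x => k (x, y)) by exact: measurableT_comp.
have i1 x : itg (fun y => q y * k (x, y)) by apply: itgM.
have i2 y : itg (fun x => p x * k (x, y)) by apply: itgM.
have mf : measurable_fun setT (fun z : R * R => p z.1 * (q z.2 * k z)).
  apply: measurable_funM; first exact: measurableT_comp.
  by apply: measurable_funM => //; exact: measurableT_comp.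
(* Tonelli: the iterated integral of the absolute value is at most [M] times the product of the L1
   norms of [p] and [q]. *)
have imf : (mu \x mu)%E.-integrable setT (fun z : R * R => (p z.1 * (q z.2 * k z))%:E).
  apply/integrable12ltyP; first exact/measurable_EFinP.
  apply: (@le_lt_trans _ _ (\int[mu]_x ((M * \int[mu]_y `|q y|) * `|p x|)%:E)%E); last first.
    by have /integrableP[_] := itgZ (M * \int[mu]_y `|q y|) (itg_abs ip); apply: le_lt_trans;
      apply: ge0_le_integral => //=; [move=> x _; rewrite lee_fin mulr_ge0 // mulr_ge0 ?Rintegral_ge0 //; exact: le_trans (kM (0, 0))|
      apply/measurable_EFinP; apply: measurable_funM => //; exact: measurableT_comp|
      do 2 apply: measurableT_comp => //; apply: measurable_funM => //; exact: measurableT_comp|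
      move=> x _; rewrite lee_fin ler_norm].
  apply: ge0_le_integral => //.
  - by move=> x _; apply: integral_ge0.
  - apply: (@measurable_fun_fubini_tonelli_F _ _ _ _ R mu (fun z : R * R => `|(p z.1 * (q z.2 * k z))%:E|%E)) => //.
    by apply: measurableT_comp => //; exact/measurable_EFinP.
  - by apply/measurable_EFinP; apply: measurable_funM => //; exact: measurableT_comp.
  - move=> x _ /=.
    apply: (@le_trans _ _ (\int[mu]_y (M * `|p x| * `|q y|)%:E)%E).
      apply: ge0_le_integral => //.
      + apply/measurable_EFinP; apply: measurableT_comp => //; apply: measurable_funM => //.
        exact: itg_measurable (i1 x).
      + by apply/measurable_EFinP; apply: measurable_funM => //; exact: measurableT_comp.
      + move=> y _; rewrite lee_fin !normrM.
        by rewrite mulrA mulrC -[leRHS]mulrA ler_wpM2r ?mulr_ge0 ?kM.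
    rewrite -EFin_Ritg; last exact/itgZ/itg_abs.
    by rewrite RitgZ; [rewrite lee_fin mulrAC|exact: itg_abs].
have := Fubini imf.
have -> : (\int[mu]_x \int[mu]_y (p (x, y).1 * (q (x, y).2 * k (x, y)))%:E =
   \int[mu]_x (p x * \int[mu]_y (q y * k (x, y)))%:E)%E.
  by apply: eq_integral => x _ /=; rewrite -RitgZ // -EFin_Ritg //; exact: itgZ.
have -> : (\int[mu]_y \int[mu]_x (p (x, y).1 * (q (x, y).2 * k (x, y)))%:E =
   \int[mu]_y (q y * \int[mu]_x (p x * k (x, y)))%:E)%E.
  apply: eq_integral => y _ /=; rewrite -RitgZ // EFin_Ritg; last exact: itgZ.
  by apply: eq_integral => x _; rewrite mulrCA.
by move=> /(congr1 fine).
Qed.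

(** The fundamental theorem of calculus on a half-line, doubled by symmetry. [g] stands for [f]
    without its absolute values: it agrees with [f] for [x >= 0] but has a primitive on the whole
    line. *)
Lemma integral_even (f F g : R -> R) (l : R) : (forall x, 0 <= f x) -> continuous f ->
  (forall x, f (- x) = f x) -> (forall x : R, is_derive x 1 F (g x)) ->
  (forall x, 0 <= x -> f x = g x) -> F x @[x --> +oo] --> l ->
  (\int[mu]_x (f x)%:E = (2 * (l - F 0))%:E)%E.
Proof.
move=> f0 cf fe dF fg Fl.
rewrite ge0_symfun_integralT //; last by move=> x /=; rewrite fe.
rewrite -set_itvcy (@ge0_continuous_FTC2y _ f F 0 l) //.
- exact: continuous_subspaceT.
- apply: cvg_at_right_filter; apply/differentiable_continuous/derivable1_diffP.
  by have [] := dF 0.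
- move=> x; rewrite in_itv /= andbT => x0; rewrite derive1E.
  by have [_ ->] := dF x; rewrite fg // ltW.
Qed.

Definition expabs (e : R) (xi : R) : R := expR (- (e * `|xi|)).
Definition poisson (e : R) (z : R) : R := 2 * e / (e ^+ 2 + (2 * pi * z) ^+ 2).

Lemma continuous_expabs e : continuous (expabs e).
Proof.
move=> x; apply: continuous_comp; last exact: continuous_expR.
apply: continuousN; apply: continuousM; first exact: cst_continuous.
exact: norm_continuous.
Qed.

Lemma continuous_linear (b : R) : continuous (fun x : R => b * x).
Proof. by move=> x; apply: continuousM; [exact: cst_continuous|exact: cvg_id]. Qed.

Lemma continuous_cosl (b : R) : continuous (fun x : R => cos (b * x)).
Proof. by move=> x; apply: (continuous_comp (@continuous_linear b x)); exact: continuous_cos. Qed.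

Lemma continuous_sinl (b : R) : continuous (fun x : R => sin (b * x)).
Proof. by move=> x; apply: (continuous_comp (@continuous_linear b x)); exact: continuous_sin. Qed.

Lemma cvgy_expN (e : R) : 0 < e -> expR (- (e * x)) @[x --> +oo] --> (0 : R).
Proof.
move=> e0; apply: (cvg_comp (fun x : R => e * x) (fun x => expR (- x))); last exact: cvgr_expR.
by apply: gt0_cvgMry => //; exact: cvg_id.
Qed.

(** [integral_even] asks for a nonnegative integrand, so the cosine is raised by [1]. The case
    [b = 0] gives the mass of [expabs], and a subtraction then recovers the cosine integral. *)
Lemma integral_expabs_cos1 (e b : R) : 0 < e ->
  (\int[mu]_x (expabs e x * (1 + cos (b * x)))%:E = (2 * (1 / e + e / (e ^+ 2 + b ^+ 2)))%:E)%E.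
Proof.
move=> e0.
have d0 : e ^+ 2 + b ^+ 2 != 0 by rewrite gt_eqF // ltr_wpDr ?sqr_ge0 // exprn_gt0.
pose F x := expR (- (e * x)) * (- e^-1 + (b * sin (b * x) - e * cos (b * x)) / (e ^+ 2 + b ^+ 2)).
have -> : 1 / e + e / (e ^+ 2 + b ^+ 2) = 0 - F 0.
  by rewrite /F !mulr0 oppr0 expR0 sin0 cos0; field; rewrite d0 gt_eqF.
apply: (integral_even (g := fun x => expR (- (e * x)) * (1 + cos (b * x)))).
- by move=> x; rewrite mulr_ge0 ?expR_ge0 // -lerBlDl sub0r cos_geN1.
- move=> x; apply: continuousM; first exact: continuous_expabs.
  by apply: continuousD; [exact: cst_continuous|exact: continuous_cosl].
- by move=> x; rewrite /expabs normrN mulrN cosN.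
- move=> x; rewrite /F; apply: is_derive_eq.
  by rewrite /GRing.scale /=; field; rewrite d0 gt_eqF.
- by move=> x x0; rewrite /expabs ger0_norm.
- apply/norm_cvg0P; pose K := e^-1 + (`|b| + e) / (e ^+ 2 + b ^+ 2).
  have cv : K * expR (- (e * x)) @[x --> +oo] --> (0 : R).
    by rewrite -(mulr0 K); apply: cvgMr; exact: cvgy_expN.
  apply: squeeze_cvgr (cvg_cst 0) cv; apply: nearW => x.
  rewrite normr_ge0 andTb /F normrM (ger0_norm (expR_ge0 _)) [leLHS]mulrC ler_wpM2r ?expR_ge0 //.
  apply: le_trans (ler_normD _ _) _; rewrite normrN gtr0_norm ?invr_gt0 // lerD2l.
  rewrite normrM [`|_^-1|]ger0_norm ?invr_ge0 ?addr_ge0 ?sqr_ge0 // ler_wpM2r ?invr_ge0 ?addr_ge0 ?sqr_ge0 //.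
  apply: le_trans (ler_normB _ _) _; rewrite !normrM (gtr0_norm e0).
  by apply: lerD; rewrite ler_piMr // ?sin_max ?cos_max // ltW.
Qed.

Lemma ge0_itg a (r : R) : continuous a -> (forall x, 0 <= a x) ->
  (\int[mu]_x (a x)%:E = r%:E)%E -> itg a /\ \int[mu]_x a x = r.
Proof.
move=> ca a0 ir; split; last by rewrite /Rintegral ir.
rewrite /itg; apply/integrableP; split; first by apply/measurable_EFinP; exact: continuous_measurable_fun.
by under eq_integral do rewrite /= ger0_norm //; rewrite ir ltry.
Qed.

Lemma itg_expabs (e : R) : 0 < e -> itg (expabs e) /\ \int[mu]_x expabs e x = 2 / e.
Proof.
move=> e0; have /ge0_itg[] := @integral_expabs_cos1 e 0 e0.
- move=> x; apply: continuousM; first exact: continuous_expabs.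
  by apply: continuousD; [exact: cst_continuous|exact: continuous_cosl].
- by move=> x; rewrite mulr_ge0 ?expR_ge0 // -lerBlDl sub0r cos_geN1.
have -> : (fun x => expabs e x * (1 + cos (0 * x))) = (fun x => 2 * expabs e x).
  by apply/funext => x; rewrite mul0r cos0; ring.
move=> /(itgZ 2^-1); rewrite (_ : (fun x => _) = expabs e); last by apply/funext => x; field.
move=> i; rewrite RitgZ // => h; split => //.
apply: (@mulfI _ 2) => //; rewrite h; field; by rewrite gt_eqF.
Qed.

Lemma integral_expabs_cos (e z : R) : 0 < e ->
  \int[mu]_x (expabs e x * cos (2 * pi * z * x)) = poisson e z.
Proof.
move=> e0; have /ge0_itg[] := @integral_expabs_cos1 e (2 * pi * z) e0.
- move=> x; apply: continuousM; first exact: continuous_expabs.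
  by apply: continuousD; [exact: cst_continuous|exact: continuous_cosl].
- by move=> x; rewrite mulr_ge0 ?expR_ge0 // -lerBlDl sub0r cos_geN1.
have [i1 v1] := itg_expabs e0.
move=> i2 v2; rewrite (_ : \int[mu]_x _ = \int[mu]_x (expabs e x * (1 + cos (2 * pi * z * x)) - expabs e x)).
  by rewrite RitgB // v1 v2 /poisson; ring.
by apply: eq_Rintegral => x _; ring.
Qed.

Lemma poisson_ge0 (e z : R) : 0 <= e -> 0 <= poisson e z.
Proof. by move=> e0; rewrite /poisson mulr_ge0 ?mulr_ge0 // invr_ge0 addr_ge0 ?sqr_ge0. Qed.

Lemma continuous_poisson (e : R) : 0 < e -> continuous (poisson e).
Proof.
move=> e0; rewrite /poisson => x; apply: cvgM; first exact: cvg_cst.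
apply: cvgV; first by rewrite gt_eqF // ltr_wpDr ?sqr_ge0 // exprn_gt0.
apply: cvgD; first exact: cvg_cst.
apply: (cvg_comp (fun x : R => 2 * pi * x) (fun u : R => u ^+ 2)); first exact: continuous_linear.
exact: exprn_continuous.
Qed.

Lemma itg_poisson1 : itg (poisson 1) /\ \int[mu]_x poisson 1 x = 1.
Proof.
apply: ge0_itg; [exact: continuous_poisson|by move=> x; exact: poisson_ge0|].
have p0 := pi_gt0 R.
pose F (x : R) := atan (2 * pi * x) / pi.
rewrite [X in _ = X%:E](_ : _ = 2 * (2^-1 - F 0)); last by rewrite /F mulr0 atan0 mul0r subr0 divff.
apply: (integral_even (g := poisson 1)) => //.
- by move=> x; exact: poisson_ge0.
- exact: continuous_poisson.
- by move=> x; rewrite /poisson mulrN sqrrN.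
- move=> x; rewrite /F; apply: is_derive_eq.
  have sE (r s : R) : r *: s = r * s by [].
  have pn : (pi : R) != 0 by rewrite gt_eqF.
  have dn : 1 + (2 * pi * x) ^+ 2 != 0 by rewrite gt_eqF // ltr_wpDr ?sqr_ge0.
  rewrite !sE /poisson expr1n; move: (pi) pn dn => P pn dn; field.
  by rewrite dn pn.
- rewrite /F (_ : 2^-1 = pi / 2 / pi); last first.
    by move: (pi) p0 => P P0; field; rewrite gt_eqF.
  apply: cvgMl; apply: (cvg_comp (fun x : R => 2 * pi * x) (@atan R)); last exact: cvgy_atan.
  by apply: gt0_cvgMry; [rewrite mulr_gt0|exact: cvg_id].
Qed.

End RealTransforms.

(** * Plancherel for bounded continuous integrable real functions *)

Section RealPlancherel.
Context {R : realType}.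
Local Notation mu := (@lebesgue_measure R).
Implicit Types (a b c p q : R -> R).

Definition costr a (xi : R) : R := \int[mu]_x (a x * cos (2 * pi * x * xi)).
Definition sintr a (xi : R) : R := \int[mu]_x (a x * sin (2 * pi * x * xi)).

Lemma measurable_cosl (r : R) : measurable_fun setT (fun x : R => cos (r * x)).
Proof. by apply: continuous_measurable_fun; exact: continuous_cosl. Qed.

Lemma measurable_sinl (r : R) : measurable_fun setT (fun x : R => sin (r * x)).
Proof. by apply: continuous_measurable_fun; exact: continuous_sinl. Qed.

Lemma itg_cos a xi : itg a -> itg (fun x => a x * cos (2 * pi * x * xi)).
Proof.
move=> ia; apply: (itgM (M := 1)) => //; last by move=> x; exact: cos_max.
rewrite (_ : (fun x => _) = (fun x => cos (2 * pi * xi * x))); first exact: measurable_cosl.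
by apply/funext => x; rewrite mulrAC.
Qed.

Lemma itg_sin a xi : itg a -> itg (fun x => a x * sin (2 * pi * x * xi)).
Proof.
move=> ia; apply: (itgM (M := 1)) => //; last by move=> x; exact: sin_max.
rewrite (_ : (fun x => _) = (fun x => sin (2 * pi * xi * x))); first exact: measurable_sinl.
by apply/funext => x; rewrite mulrAC.
Qed.

Lemma continuous_costr a : itg a -> continuous (costr a).
Proof.
move=> ia xi; have := @continuity_under_integral R _ _ mu (fun xi x => a x * cos (2 * pi * x * xi)) setT measurableT (xi - 1) (xi + 1) _ _ (fun x => `|a x|) (itg_abs ia) _.
apply.
- by move=> y _; exact: itg_cos.
- by apply: aeW => y _ z _; apply: cvgM; [exact: cvg_cst|exact: continuous_cosl].
- by move=> y _; apply: aeW => z _; rewrite normrM ler_piMr // cos_max.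
- by rewrite inE /= in_itv /=; apply/andP; split; lra.
Qed.

Lemma continuous_sintr a : itg a -> continuous (sintr a).
Proof.
move=> ia xi; have := @continuity_under_integral R _ _ mu (fun xi x => a x * sin (2 * pi * x * xi)) setT measurableT (xi - 1) (xi + 1) _ _ (fun x => `|a x|) (itg_abs ia) _.
apply.
- by move=> y _; exact: itg_sin.
- by apply: aeW => y _ z _; apply: cvgM; [exact: cvg_cst|exact: continuous_sinl].
- by move=> y _; apply: aeW => z _; rewrite normrM ler_piMr // sin_max.
- by rewrite inE /= in_itv /=; apply/andP; split; lra.
Qed.

Lemma costr_bound a xi : itg a -> `|costr a xi| <= \int[mu]_x `|a x|.
Proof.
move=> ia; apply: le_trans (le_normr_Rintegral measurableT (itg_cos xi ia)) _.
apply: Ritg_le; [exact/itg_abs/itg_cos|exact: itg_abs|].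
by move=> x; rewrite normrM ler_piMr // cos_max.
Qed.

Lemma sintr_bound a xi : itg a -> `|sintr a xi| <= \int[mu]_x `|a x|.
Proof.
move=> ia; apply: le_trans (le_normr_Rintegral measurableT (itg_sin xi ia)) _.
apply: Ritg_le; [exact/itg_abs/itg_sin|exact: itg_abs|].
by move=> x; rewrite normrM ler_piMr // sin_max.
Qed.

(* Abel means of the Fourier inversion integral of [a]. *)
Definition abel a (e x : R) : R :=
  \int[mu]_xi (expabs e xi * (costr a xi * cos (2 * pi * x * xi) + sintr a xi * sin (2 * pi * x * xi))).

(** The addition formula for the cosine; it is what makes the Abel mean a convolution. *)
Lemma shift_costr a x xi : itg a ->
  costr a xi * cos (2 * pi * x * xi) + sintr a xi * sin (2 * pi * x * xi) =
  \int[mu]_y (a y * cos (2 * pi * (x - y) * xi)).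
Proof.
move=> ia; rewrite /costr /sintr mulrC [X in _ + X]mulrC -!RitgZ; [|exact: itg_sin|exact: itg_cos].
rewrite -RitgD; [|exact/itgZ/itg_cos|exact/itgZ/itg_sin].
apply: eq_Rintegral => y _; rewrite (_ : 2 * pi * (x - y) * xi = 2 * pi * x * xi - 2 * pi * y * xi); last by ring.
by rewrite cosB; ring.
Qed.

Lemma abel_poisson a (e x : R) : 0 < e -> itg a ->
  abel a e x = \int[mu]_y (a y * poisson e (x - y)).
Proof.
move=> e0 ia; have [ie _] := itg_expabs e0.
rewrite /abel; under eq_Rintegral do rewrite shift_costr //.
rewrite (@itg_Fubini R (expabs e) a (fun z => cos (2 * pi * (x - z.2) * z.1)) 1) //.
- by apply: eq_Rintegral => y _; rewrite /= integral_expabs_cos.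
- apply: (measurableT_comp (f := @cos R)).
    by apply: continuous_measurable_fun; exact: continuous_cos.
  apply: measurable_funM => //; apply: measurable_funM => //; exact: measurable_funB.
- by move=> z; exact: cos_max.
Qed.

(** [abel a e] is itself a cosine transform plus a sine transform, of functions damped by [expabs].
    Continuity supplies the measurability used in [real_plancherel]. *)
Lemma continuous_abel a (e : R) : 0 < e -> itg a -> continuous (abel a e).
Proof.
move=> e0 ia; have [ie _] := itg_expabs e0.
have i1 : itg (fun xi => expabs e xi * costr a xi).
  apply: (itgM ie _ (fun xi => costr_bound xi ia)).
  by apply: continuous_measurable_fun; exact: continuous_costr.
have i2 : itg (fun xi => expabs e xi * sintr a xi).
  apply: (itgM ie _ (fun xi => sintr_bound xi ia)).
  by apply: continuous_measurable_fun; exact: continuous_sintr.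
rewrite (_ : abel a e = (fun x => costr (fun xi => expabs e xi * costr a xi) x + sintr (fun xi => expabs e xi * sintr a xi) x)).
  by move=> x; apply: cvgD; [exact: continuous_costr|exact: continuous_sintr].
apply/funext => x; rewrite /abel /costr /sintr -RitgD; [|exact: itg_cos|exact: itg_sin].
apply: eq_Rintegral => xi _; rewrite mulrDr !mulrA.
by rewrite (_ : 2 * pi * x * xi = 2 * pi * xi * x) // mulrAC.
Qed.

(** One factor of each square is opened as an integral over [x]; after Fubini the remaining integral
    in [xi] is the Abel mean at [x]. *)
Lemma abel_sqr a (e : R) : 0 < e -> itg a ->
  \int[mu]_xi (expabs e xi * (costr a xi ^+ 2 + sintr a xi ^+ 2)) = \int[mu]_x (a x * abel a e x).
Proof.
move=> e0 ia; have [ie _] := itg_expabs e0.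
rewrite /abel.
rewrite -(@itg_Fubini R (expabs e) a (fun z => costr a z.1 * cos (2 * pi * z.2 * z.1) + sintr a z.1 * sin (2 * pi * z.2 * z.1))
   (\int[mu]_x `|a x| + \int[mu]_x `|a x|)) //.
- apply: eq_Rintegral => xi _ /=; congr (_ * _); rewrite !expr2 {2}/costr {2}/sintr.
  rewrite -!RitgZ; [|exact: itg_sin|exact: itg_cos].
  rewrite -RitgD; [|exact/itgZ/itg_cos|exact/itgZ/itg_sin].
  by apply: eq_Rintegral => x _; ring.
- have ml : measurable_fun setT (fun z : R * R => 2 * pi * z.2 * z.1).
    by apply: measurable_funM => //; exact: measurable_funM.
  apply: measurable_funD; apply: measurable_funM.
  + apply: (measurableT_comp (f := costr a)) => //.
    by apply: continuous_measurable_fun; exact: continuous_costr.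
  + apply: (measurableT_comp (f := @cos R)) => //.
    by apply: continuous_measurable_fun; exact: continuous_cos.
  + apply: (measurableT_comp (f := sintr a)) => //.
    by apply: continuous_measurable_fun; exact: continuous_sintr.
  + apply: (measurableT_comp (f := @sin R)) => //.
    by apply: continuous_measurable_fun; exact: continuous_sin.
- move=> z; apply: le_trans (ler_normD _ _) _; apply: lerD; rewrite normrM.
    by rewrite -[leRHS]mulr1 ler_pM ?costr_bound ?cos_max.
  by rewrite -[leRHS]mulr1 ler_pM ?sintr_bound ?sin_max.
Qed.

Lemma poisson_scale (e x z : R) : 0 < e -> poisson e (x - (e * z + x)) * e = poisson 1 z.
Proof.
move=> e0; rewrite /poisson expr1n mulr1.
have en : e != 0 by rewrite gt_eqF.
have d1 : 1 + (2 * pi * z) ^+ 2 != 0 by rewrite gt_eqF // ltr_wpDr ?sqr_ge0.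
have d2 : e ^+ 2 + (2 * pi * (x - (e * z + x))) ^+ 2 != 0.
  by rewrite gt_eqF // ltr_wpDr ?sqr_ge0 // exprn_gt0.
move: (pi) d1 d2 => P d1 d2; field.
by rewrite d1.
Qed.

(** The substitution [y = e z + x] moves the parameter [e] from the kernel to the function. *)
Lemma poisson_subst (G : R -> R) (e x : R) : 0 < e -> continuous G -> (forall y, 0 <= G y) ->
  (\int[mu]_y (G y * poisson e (x - y))%:E = \int[mu]_z (G (e * z + x)%R * poisson 1 z)%:E)%E.
Proof.
move=> e0 cG G0; pose F (z : R) := e * z + x.
have dF (z : R) : is_derive z 1 F e.
  by rewrite /F; apply: is_derive_eq; rewrite addr0 /GRing.scale /= mulr1.
have F'E : (F^`())%classic = cst e by apply/funext => z; rewrite derive1E; have [] := dF z.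
have cP : continuous (fun y => poisson e (x - y)).
  move=> y; apply: (cvg_comp (fun y => x - y) (poisson e)); last exact: continuous_poisson.
  by apply: cvgB; [exact: cvg_cst|exact: cvg_id].
rewrite (@increasing_ge0_integration_by_substitutionT R F (fun y => G y * poisson e (x - y))).
- by apply: eq_integral => z _; rewrite F'E !fctE -mulrA /F poisson_scale.
- by move=> u v uv; rewrite /F ltrD2r ltr_pM2l.
- by rewrite F'E => z; exact: cst_continuous.
- by rewrite F'E; exact: is_cvg_cst.
- by rewrite F'E; exact: is_cvg_cst.
- by move=> z; have [] := dF z.
- apply/cvgrNyPle => A; apply: filterS (nbhs_ninfty_le (num_real ((A - x) / e))) => z.
  by rewrite /F => h; rewrite -lerBrDr mulrC -ler_pdivlMr.
- apply/cvgryPge => A; apply: filterS (nbhs_pinfty_ge (num_real ((A - x) / e))) => z.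
  by rewrite /F => h; rewrite -lerBlDr mulrC -ler_pdivrMr.
- by move=> y; apply: cvgM; [exact: cG|exact: cP].
- by move=> y; rewrite mulr_ge0 // poisson_ge0 // ltW.
Qed.

Lemma itg_poisson_shift (e x : R) : 0 < e ->
  itg (fun y => poisson e (x - y)) /\ \int[mu]_y poisson e (x - y) = 1.
Proof.
move=> e0; apply: ge0_itg.
- move=> y; apply: (cvg_comp (fun y => x - y) (poisson e)); last exact: continuous_poisson.
  by apply: cvgB; [exact: cvg_cst|exact: cvg_id].
- by move=> y; rewrite poisson_ge0 // ltW.
- have [i1 v1] := @itg_poisson1 R.
  rewrite -v1 EFin_Ritg //.
  transitivity (\int[mu]_y (1 * poisson e (x - y))%:E)%E.
    by apply: eq_integral => y _; rewrite mul1r.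
  rewrite (@poisson_subst (fun=> 1)) //; last exact: cst_continuous.
  by apply: eq_integral => y _; rewrite mul1r.
Qed.

Lemma abel_shift a (M e x : R) : 0 < e -> continuous a -> itg a -> (forall y, `|a y| <= M) ->
  abel a e x = \int[mu]_z (a (e * z + x) * poisson 1 z).
Proof.
move=> e0 ca ia aM; rewrite abel_poisson //.
have [i1 v1] := @itg_poisson1 R; have [ie ve] := itg_poisson_shift x e0.
have cs : continuous (fun z => a (e * z + x)).
  move=> z; apply: (cvg_comp (fun z => e * z + x) a); last exact: ca.
  by apply: cvgD; [exact: continuous_linear|exact: cvg_cst].
have j1 : itg (fun z => a (e * z + x) * poisson 1 z).
  have := itgM i1 (continuous_measurable_fun cs) (fun z => aM _).
  by under eq_fun do rewrite mulrC.
have j2 : itg (fun y => a y * poisson e (x - y)).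
  have := itgM ie (continuous_measurable_fun ca) aM.
  by under eq_fun do rewrite mulrC.
(* Adding [M] makes the integrand nonnegative, as [poisson_subst] requires; the kernel has mass one
   on both sides, so the extra [M] cancels. *)
have : (\int[mu]_y ((a y + M) * poisson e (x - y))%:E = \int[mu]_z ((a (e * z + x)%R + M) * poisson 1 z)%:E)%E.
  apply: (@poisson_subst (fun y => a y + M)) => //.
    by move=> y; apply: cvgD; [exact: ca|exact: cvg_cst].
  by move=> y; have := aM y; rewrite ler_norml => /andP[+ _]; rewrite -subr_ge0 opprK.
have -> : (\int[mu]_y ((a y + M) * poisson e (x - y))%:E = (\int[mu]_y (a y * poisson e (x - y)) + M)%:E)%E.
  rewrite -[X in (_ + X)%:E]mulr1 -ve -RitgZ // -RitgD //; last exact: itgZ.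
  rewrite EFin_Ritg; last exact: itgD j2 (itgZ _ ie).
  by apply: eq_integral => y _; rewrite mulrDl.
have -> : (\int[mu]_z ((a (e * z + x)%R + M) * poisson 1 z)%:E = (\int[mu]_z (a (e * z + x)%R * poisson 1 z) + M)%:E)%E.
  have MP : M = \int[mu]_z (M * poisson 1 z) by rewrite RitgZ // v1 mulr1.
  rewrite [X in (_ + X)%:E]MP -RitgD //; last exact: itgZ.
  rewrite EFin_Ritg; last exact: itgD j1 (itgZ _ i1).
  by apply: eq_integral => y _; rewrite mulrDl.
by case=> /addIr.
Qed.

Lemma abel_bound a (M e x : R) : 0 < e -> continuous a -> itg a -> (forall y, `|a y| <= M) ->
  `|abel a e x| <= M.
Proof.
move=> e0 ca ia aM; rewrite abel_poisson //.
have [ie ve] := itg_poisson_shift x e0.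
have j2 : itg (fun y => a y * poisson e (x - y)).
  have := itgM ie (continuous_measurable_fun ca) aM.
  by under eq_fun do rewrite mulrC.
apply: le_trans (le_normr_Rintegral measurableT j2) _.
rewrite -[leRHS]mulr1 -ve -RitgZ //; apply: Ritg_le; [exact: itg_abs|exact: itgZ|].
move=> y; have p0 : 0 <= poisson e (x - y) by rewrite poisson_ge0 // ltW.
by rewrite normrM (ger0_norm p0) ler_wpM2r.
Qed.

Lemma Ritg_dominated (u : nat -> R -> R) (v g : R -> R) :
  (forall n, measurable_fun setT (u n)) -> (forall x, u n x @[n --> \oo] --> v x) ->
  itg g -> (forall n x, `|u n x| <= g x) ->
  [/\ itg v, \int[mu]_x `|u n x - v x| @[n --> \oo] --> (0 : R) &
      \int[mu]_x u n x @[n --> \oo] --> \int[mu]_x v x].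
Proof.
move=> mU uv ig ug.
have mv : measurable_fun setT v by apply: measurable_fun_cvg mU _ => x _; exact: uv.
have [|||||h1 h2 h3] := @dominated_convergence _ _ _ mu setT measurableT (fun n x => (u n x)%:E) (EFin \o v) (EFin \o g).
- by move=> n; apply/measurable_EFinP; exact: mU.
- by apply/measurable_EFinP; exact: mv.
- by apply: aeW => x _; apply/fine_cvgP; split; [exact: nearW|exact: uv].
- exact: ig.
- by apply: aeW => x n _; rewrite lee_fin.
split => //; first exact: fine_cvg h2.
apply: fine_cvg; rewrite fineK; first exact: h3.
exact: integrable_fin_num h1.
Qed.

(** After rescaling the kernel is the fixed [poisson 1]: continuity of [a] at [x] gives the
    pointwise limit and [M * poisson 1] dominates. *)
Lemma abel_cvg a (M x : R) : continuous a -> itg a -> (forall y, `|a y| <= M) ->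
  abel a n.+1%:R^-1 x @[n --> \oo] --> a x.
Proof.
move=> ca ia aM; have [i1 v1] := @itg_poisson1 R.
have e0 n : 0 < n.+1%:R^-1 :> R by [].
have -> : a x = \int[mu]_z (a x * poisson 1 z) by rewrite RitgZ // v1 mulr1.
have -> : (fun n => abel a n.+1%:R^-1 x) = (fun n => \int[mu]_z (a (n.+1%:R^-1 * z + x) * poisson 1 z)).
  by apply/funext => n; rewrite (abel_shift _ (e0 _) ca ia aM).
have := @Ritg_dominated (fun n z => a (n.+1%:R^-1 * z + x) * poisson 1 z) (fun z => a x * poisson 1 z) (fun z => M * poisson 1 z).
case=> //.
- move=> n; apply: measurable_funM; last exact: itg_measurable i1.
  apply: continuous_measurable_fun => z; apply: (cvg_comp (fun z => n.+1%:R^-1 * z + x) a); last exact: ca.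
  by apply: cvgD; [exact: continuous_linear|exact: cvg_cst].
- move=> z; apply: cvgM; last exact: cvg_cst.
  apply: (cvg_comp (fun n : nat => n.+1%:R^-1 * z + x) a); last exact: ca.
  have {2}-> : x = 0 * z + x by rewrite mul0r add0r.
  apply: cvgD; last exact: cvg_cst.
  by apply: cvgM; [exact: cvg_harmonic|exact: cvg_cst].
- exact: itgZ.
- by move=> n z; rewrite normrM (ger0_norm (poisson_ge0 _ ler01)) ler_wpM2r // poisson_ge0.
Qed.

(** The left side is not known to be finite in advance, so it is reached by monotone convergence:
    [expabs e] increases as [e] decreases. The right side converges by domination by [M * |a|]. *)
Lemma real_plancherel a (M : R) : continuous a -> itg a -> (forall y, `|a y| <= M) ->
  (\int[mu]_xi (costr a xi ^+ 2 + sintr a xi ^+ 2)%:E = (\int[mu]_x (a x ^+ 2))%:E)%E.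
Proof.
move=> ca ia aM.
have e0 n : 0 < n.+1%:R^-1 :> R by [].
have cc : continuous (fun xi => costr a xi ^+ 2 + sintr a xi ^+ 2).
  move=> xi; apply: cvgD.
    apply: (cvg_comp (costr a) (fun u : R => u ^+ 2)); first exact: continuous_costr.
    exact: exprn_continuous.
  apply: (cvg_comp (sintr a) (fun u : R => u ^+ 2)); first exact: continuous_sintr.
  exact: exprn_continuous.
have sq0 xi : 0 <= costr a xi ^+ 2 + sintr a xi ^+ 2 by rewrite addr_ge0 ?sqr_ge0.
have cl : (\int[mu]_xi (expabs n.+1%:R^-1 xi * (costr a xi ^+ 2 + sintr a xi ^+ 2))%:E)%E @[n --> \oo]
   --> (\int[mu]_xi (costr a xi ^+ 2 + sintr a xi ^+ 2)%:E)%E.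
  have lim1 xi : expabs n.+1%:R^-1 xi * (costr a xi ^+ 2 + sintr a xi ^+ 2) @[n --> \oo] -->
       costr a xi ^+ 2 + sintr a xi ^+ 2.
    rewrite -[X in _ --> X]mul1r; apply: cvgM; last exact: cvg_cst.
    rewrite [X in _ --> X](_ : _ = expR (- (0 * `|xi|))); last by rewrite mul0r oppr0 expR0.
    apply: (cvg_comp (fun n : nat => - (n.+1%:R^-1 * `|xi|)) expR); last exact: continuous_expR. apply: cvgN; apply: cvgM; [exact: cvg_harmonic|exact: cvg_cst].
  rewrite [X in _ --> X](_ : _ = \int[mu]_xi limn (fun n => (expabs n.+1%:R^-1 xi * (costr a xi ^+ 2 + sintr a xi ^+ 2))%:E))%E.
    apply: cvg_monotone_convergence => //.
    - move=> n; apply/measurable_EFinP/measurable_funM.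
        by apply: continuous_measurable_fun; exact: continuous_expabs.
      exact: continuous_measurable_fun.
    - by move=> n x _; rewrite lee_fin mulr_ge0 // expR_ge0.
    - move=> x _ m n mn; rewrite lee_fin ler_wpM2r // ler_expR lerN2 ler_wpM2r //.
      by rewrite lef_pV2 ?posrE // ler_nat.
  apply: eq_integral => xi _; apply/esym/cvg_lim => //.
  by apply/fine_cvgP; split; [exact: nearW|exact: lim1].
have cr : (\int[mu]_x (a x * abel a n.+1%:R^-1 x))%:E @[n --> \oo] --> (\int[mu]_x (a x ^+ 2))%:E.
  apply/fine_cvgP; split; first exact: nearW.
  have := @Ritg_dominated (fun n x => a x * abel a n.+1%:R^-1 x) (fun x => a x ^+ 2) (fun x => M * `|a x|).
  case=> //.
  - move=> n; apply: measurable_funM; first exact: continuous_measurable_fun.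
    by apply: continuous_measurable_fun; exact: continuous_abel.
  - move=> x; rewrite expr2; apply: cvgM; first exact: cvg_cst.
    exact: abel_cvg aM.
  - exact/itgZ/itg_abs.
  - by move=> n x; rewrite normrM mulrC ler_wpM2r // (abel_bound _ (e0 n) ca ia aM).
apply: (cvg_unique (@ereal_hausdorff R) cl).
  rewrite (_ : (fun n => _) = (fun n => (\int[mu]_x (a x * abel a n.+1%:R^-1 x))%:E)) //.
  apply/funext => n; rewrite -abel_sqr // EFin_Ritg //.
  have [ie _] := itg_expabs (e0 n).
  pose K := (\int[mu]_x `|a x|) ^+ 2 + (\int[mu]_x `|a x|) ^+ 2.
  apply: (itgM (M := K) ie); first exact: continuous_measurable_fun.
  move=> xi; rewrite ger0_norm // /K; apply: lerD; rewrite -[leLHS]real_normK ?num_real //;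
  by rewrite ler_pXn2r ?nnegrE ?Rintegral_ge0 // ?costr_bound ?sintr_bound.
Qed.

End RealPlancherel.

(** * Density of bounded continuous integrable functions *)

Section Density.
Context {R : realType}.
Local Notation mu := (@lebesgue_measure R).
Implicit Types (a b c p q : R -> R).

Definition clip (M x : R) : R := Num.max (- M) (Num.min M x).

Lemma clip_bound (M x : R) : 0 <= M -> `|clip M x| <= M.
Proof. by move=> M0; rewrite ler_norml /clip le_max lexx /= ge_max ge_min lexx /= andbT; lra. Qed.

Lemma clip_dist (M x y : R) : `|x| <= M -> `|x - clip M y| <= `|x - y|.
Proof.
rewrite ler_norml => /andP[h1 h2]; rewrite /clip.
(* The sign condition says that [z] lies between [x] and [y]. *)
have key z : (z - x) * (z - y) <= 0 -> `|x - z| <= `|x - y|.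
  by move=> zz; case: (ler0P (x - y)) => h5; rewrite ler_norml; apply/andP; split; nra.
case: (leP M y) => h3; [case: (leP (- M) M) => h4|case: (leP (- M) y) => h4]; apply: key; nra.
Qed.

Definition tent (K x : R) : R := Num.min 1 (Num.max 0 (K + 1 - `|x|)).

Lemma tent_bound K x : 0 <= tent K x <= 1.
Proof. by rewrite /tent le_min ler01 le_max lexx ge_min lexx. Qed.

Lemma tent1 K x : `|x| <= K -> tent K x = 1.
Proof.
move=> xK; rewrite /tent; apply/min_idPl; rewrite le_max; apply/orP; right; lra.
Qed.

Lemma tent0 K x : K + 1 <= `|x| -> tent K x = 0.
Proof.
move=> xK; rewrite /tent; have /max_idPl -> : K + 1 - `|x| <= 0 by lra.
by apply/min_idPr; rewrite ler01.
Qed.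

Lemma continuous_cutoff (K M : R) (h : R -> R) : continuous h ->
  continuous (fun x => tent K x * clip M (h x)).
Proof.
move=> ch x; apply: cvgM.
  apply: (@continuous_min _ _ (cst 1) (fun x => Num.max 0 (K + 1 - `|x|)) x); first exact: cst_continuous.
  apply: (@continuous_max _ _ (cst 0) (fun x => K + 1 - `|x|) x); first exact: cst_continuous.
  by apply: cvgB; [exact: cvg_cst|exact: norm_continuous].
apply: (@continuous_max _ _ (cst (- M)) (fun x => Num.min M (h x)) x); first exact: cst_continuous.
by apply: (@continuous_min _ _ (cst M) h x); [exact: cst_continuous|exact: ch].
Qed.

Lemma itg_bounded_supp a (K M : R) : measurable_fun setT a -> (forall x, `|a x| <= M) ->
  (forall x, K < `|x| -> a x = 0) -> itg a.
Proof.
move=> ma aM aK; have M0 : 0 <= M by exact: le_trans (aM 0).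
apply: (@itg_le _ _ (fun x => M * \1_(`[-K, K]%classic : set R) x)) => //.
  apply: itgZ; have := @integrable_indic_itv R (-K) K true false.
  by [].
move=> x; rewrite indicE; case: (lerP `|x| K) => [xK|Kx].
  by rewrite mem_set ?mulr1 // /= in_itv /= -ler_norml.
by rewrite aK // normr0 mulr_ge0.
Qed.

(** Continuous L1 approximation on a compact interval, followed by clipping and a tent cutoff.
    Neither modification increases the distance to [a], which is bounded by [M] and zero beyond [K];
    the margin of length [1] is where the tent descends. *)
Lemma approx_bounded a (K M d : R) : measurable_fun setT a -> (forall x, `|a x| <= M) ->
  (forall x, K < `|x| -> a x = 0) -> 0 < d ->
  exists g, [/\ continuous g, itg g, forall x, `|g x| <= M & \int[mu]_x `|a x - g x| < d].
Proof.
move=> ma aM aK d0; have M0 : 0 <= M by exact: le_trans (aM 0).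
have ia := itg_bounded_supp ma aM aK.
pose E : set R := `[- (K + 1), K + 1]%classic.
have mE : measurable E by exact: measurable_itv.
have iaE : mu.-integrable E (EFin \o a) by apply: integrableS ia.
have [|h [ch ih hlim]] := approximation_continuous_integrable mE _ iaE.
  by apply: compact_finite_measure; exact: segment_compact.
have [n hn] : exists n, (\int[mu]_(z in E) `|(a z - h n z)%:E| < d%:E)%E.
  have /fine_cvgP[fin /cvgr0_norm_lt /(_ _ d0)] := hlim.
  move=> lt; have [n [fn ln]] := filter_ex (filterI fin lt).
  exists n; rewrite -(fineK fn) lte_fin; apply: le_lt_trans ln; exact: ler_norm.
pose g x := tent K x * clip M (h n x).
have cg : continuous g by exact: continuous_cutoff.
have gM x : `|g x| <= M.
  have /andP[t0 t1] := tent_bound K x.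
  by rewrite /g normrM (ger0_norm t0) -[leRHS]mul1r ler_pM // clip_bound.
have ig : itg g.
  apply: (@itg_bounded_supp g (K + 1) M) => //; first exact: continuous_measurable_fun.
  by move=> x Kx; rewrite /g tent0 ?mul0r // ltW.
exists g; split => //; rewrite -lte_fin EFin_Ritg; last by apply/itg_abs/itgB.
apply: le_lt_trans hn; rewrite [leRHS]integral_mkcond; apply: ge0_le_integral => //.
- by apply/measurable_EFinP; exact: itg_measurable (itg_abs (itgB ia ig)).
- apply/(measurable_restrictT _ _).1 => //; apply: measurable_funTS; apply/measurable_EFinP.
  apply: measurableT_comp => //; apply: measurable_funB => //; exact: continuous_measurable_fun.
- move=> x _; rewrite patchE; case: ifPn => [_|/negP xE] /=.
    rewrite lee_fin /g; case: (lerP `|x| K) => [xK|Kx].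
      by rewrite tent1 // mul1r clip_dist.
    rewrite aK // !sub0r !normrN normrM; have /andP[t0 t1] := tent_bound K x.
    rewrite (ger0_norm t0); apply: (@le_trans _ _ `|clip M (h n x)|).
      by rewrite ler_piMl.
    by have := @clip_dist M 0 (h n x); rewrite !sub0r !normrN normr0 => /(_ M0).
  have Kx : K + 1 < `|x|.
    by rewrite ltNge; apply/negP => h1; apply: xE; rewrite inE /E /= in_itv /= -ler_norml.
  by rewrite aK ?(lt_trans _ Kx) ?ltrDl // /g tent0 ?mul0r ?subr0 ?normr0 // ltW.
Qed.

(** [a] is truncated in size and in domain, then approximated in L1; boundedness upgrades this to
    L2. One sequence serves both norms, because Plancherel needs L2 convergence and pointwise
    convergence of the transforms needs L1 convergence. *)
Lemma dense_real a : measurable_fun setT a -> itg (fun x => a x ^+ 2) ->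
  exists g : nat -> R -> R,
    [/\ forall n, [/\ continuous (g n), itg (g n) & exists M : R, forall x, `|g n x| <= M],
        forall n, itg (fun x => (a x - g n x) ^+ 2),
        \int[mu]_x (a x - g n x) ^+ 2 @[n --> \oo] --> (0 : R) &
        itg a -> \int[mu]_x `|a x - g n x| @[n --> \oo] --> (0 : R)].
Proof.
move=> ma ia2.
pose S n : set R := [set x | `|x| <= n%:R] `&` [set x | `|a x| <= n%:R].
have mS n : measurable (S n).
  apply: measurableI.
    have -> : [set x : R | `|x| <= n%:R] = `[- n%:R, n%:R]%classic.
      by apply/seteqP; split => x /=; rewrite in_itv /= ler_norml.
    by [].
  have := @measurable_fun_ler _ R R setT (fun x => `|a x|) (fun=> n%:R) _ _.
  have -> : [set x | `|a x| <= n%:R] = setT `&` (fun x => `|a x| <= n%:R) @^-1` [set true].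
    by rewrite setTI.
  by apply => //; exact: measurableT_comp.
pose an n x := a x * \1_(S n) x.
have mind n : measurable_fun setT (\1_(S n) : R -> R) by exact: measurable_indic.
have man n : measurable_fun setT (an n) by apply: measurable_funM.
have anM n x : `|an n x| <= n%:R.
  rewrite /an indicE; case: (boolP (x \in S n)) => [/[!inE] -[_ /= h]|_]; first by rewrite mulr1.
  by rewrite mulr0 normr0.
have anK n x : n%:R < `|x| -> an n x = 0.
  move=> nx; rewrite /an indicE memNset ?mulr0 // => -[/= h _].
  by move: nx; rewrite ltNge h.
(* Since [(an - g)^2 <= 2 n |an - g|], the L1 accuracy [1 / (n + 1)^2] bounds the integral of the
   square by [2 / (n + 1)]. *)
have d0 n : 0 < (n.+1%:R^-1) ^+ 2 :> R by rewrite exprn_gt0.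
have ex n := cid (approx_bounded (man n) (anM n) (@anK n) (d0 n)).
pose g n := projT1 (ex n).
have gP n : [/\ continuous (g n), itg (g n), forall x, `|g n x| <= n%:R &
   \int[mu]_x `|an n x - g n x| < (n.+1%:R^-1) ^+ 2] by rewrite /g; case: (ex n).
have ian n : itg (an n) by apply: itg_bounded_supp (man n) (anM n) (@anK n).
have ind_cvg x : \1_(S n) x @[n --> \oo] --> (1 : R).
  apply: cvg_near_cst; have := @nbhs_infty_ger R (Num.max `|x| `|a x|).
  apply: filterS => n; rewrite ge_max => /andP[h1 h2].
  by rewrite indicE mem_set.
have an_cvg x : (a x - an n x) @[n --> \oo] --> (0 : R).
  rewrite -(subrr (a x)); apply: cvgB; first exact: cvg_cst.
  by rewrite -[X in _ --> X]mulr1; apply: cvgM; [exact: cvg_cst|exact: ind_cvg].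
have an_le n x : `|a x - an n x| <= `|a x|.
  rewrite /an indicE; case: (x \in S n); rewrite ?mulr1 ?mulr0 ?subr0 //.
  by rewrite subrr normr0.
have man' n : measurable_fun setT (fun x => a x - an n x) by exact: measurable_funB.
have [_ _ c2] : [/\ itg (cst 0 : R -> R), \int[mu]_x `|(a x - an n x) ^+ 2 - 0| @[n --> \oo] --> (0 : R) &
      \int[mu]_x (a x - an n x) ^+ 2 @[n --> \oo] --> \int[mu]_x (0 : R)].
  apply: (@Ritg_dominated R (fun n x => (a x - an n x) ^+ 2) (cst 0) (fun x => a x ^+ 2)) => //.
  - by move=> n; exact: measurable_funX.
  - move=> x; rewrite /cst -[X in _ --> X](expr0n _ 2) /=.
    apply: (cvg_comp (fun n => a x - an n x) (fun u : R => u ^+ 2)); first exact: an_cvg.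
    exact: exprn_continuous.
  - by move=> n x; rewrite normrX -[leRHS]real_normK ?num_real // lerXn2r ?nnegrE.
rewrite Rintegral_cst // mul0r in c2.
have i2 n : itg (fun x => (a x - an n x) ^+ 2).
  apply: (@itg_le _ _ (fun x => a x ^+ 2)) => //; first exact: measurable_funX.
  by move=> x; rewrite normrX -[leRHS]real_normK ?num_real // lerXn2r ?nnegrE.
have j1 n : itg (fun x => an n x - g n x) by apply: itgB => //; case: (gP n).
have gb n x : (an n x - g n x) ^+ 2 <= 2 * n%:R * `|an n x - g n x|.
  rewrite -real_normK ?num_real // expr2 ler_wpM2r //; apply: le_trans (ler_normB _ _) _.
  by rewrite mulr_natl mulr2n lerD //; case: (gP n).
have j2 n : itg (fun x => (an n x - g n x) ^+ 2).
  apply: (@itg_le _ _ (fun x => 2 * n%:R * `|an n x - g n x|)).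
  - by apply: measurable_funX; exact: itg_measurable (j1 n).
  - exact/itgZ/itg_abs.
  - by move=> x; rewrite ger0_norm ?sqr_ge0.
have k2 n : \int[mu]_x (an n x - g n x) ^+ 2 <= 2 * n.+1%:R^-1.
  apply: (@le_trans _ _ (2 * n%:R * \int[mu]_x `|an n x - g n x|)).
    by rewrite -RitgZ; [apply: Ritg_le => //; exact/itgZ/itg_abs|exact: itg_abs].
  have [_ _ _ /ltW] := gP n.
  move=> /(ler_wpM2l (_ : 0 <= 2 * n%:R :> R)) h; apply: le_trans (h _) _; first by rewrite mulr_ge0.
  rewrite -mulrA ler_wpM2l // expr2 mulrA ler_piMl ?invr_ge0 //.
  by rewrite ler_pdivrMr // mul1r ler_nat.
have sub2 n x : (a x - g n x) ^+ 2 <= 2 * (a x - an n x) ^+ 2 + 2 * (an n x - g n x) ^+ 2.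
  by have := sqr_ge0 ((a x - an n x) - (an n x - g n x)); rewrite !expr2; nra.
have mg n : measurable_fun setT (g n) by have [_ /itg_measurable] := gP n.
have l2 n : itg (fun x => (a x - g n x) ^+ 2).
  apply: (@itg_le _ _ (fun x => 2 * (a x - an n x) ^+ 2 + 2 * (an n x - g n x) ^+ 2)).
  - by apply: measurable_funX; exact: measurable_funB.
  - by apply: itgD; apply: itgZ.
  - by move=> x; rewrite ger0_norm ?sqr_ge0.
exists g; split => //.
- by move=> n; have [? ? ? _] := gP n; split => //; exists n%:R.
- have cv : 2 * \int[mu]_x (a x - an n x) ^+ 2 + 2 * (2 * n.+1%:R^-1) @[n --> \oo] --> (0 : R).
    rewrite -[X in _ --> X](addr0 0) -[X in _ --> X + _](mulr0 2) -[X in _ --> _ + X](mulr0 2); apply: cvgD.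
      by apply: cvgM; [exact: cvg_cst|exact: c2].
    apply: cvgM; first exact: cvg_cst.
    by rewrite -[X in _ --> X](mulr0 2); apply: cvgM; [exact: cvg_cst|exact: cvg_harmonic].
  apply: squeeze_cvgr (cvg_cst 0) cv; apply: nearW => n.
  rewrite Rintegral_ge0 /=; last by move=> x _; exact: sqr_ge0.
  apply: le_trans (Ritg_le (l2 n) (itgD (itgZ 2 (i2 n)) (itgZ 2 (j2 n))) (sub2 n)) _.
  by rewrite (RitgD (itgZ 2 (i2 n)) (itgZ 2 (j2 n))) !RitgZ // lerD2l ler_wpM2l.
- move=> ia.
  have [_ _ c1] : [/\ itg (cst 0 : R -> R), \int[mu]_x `| `|a x - an n x| - 0 | @[n --> \oo] --> (0 : R) &
      \int[mu]_x `|a x - an n x| @[n --> \oo] --> \int[mu]_x (0 : R)].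
    apply: (@Ritg_dominated R (fun n x => `|a x - an n x|) (cst 0) (fun x => `|a x|)) => //.
    + by move=> n; exact: measurableT_comp.
    + by move=> x; apply/norm_cvg0P; exact: an_cvg.
    + exact: itg_abs.
    + by move=> n x; rewrite normr_id.
  rewrite Rintegral_cst // mul0r in c1.
  have cv : \int[mu]_x `|a x - an n x| + (n.+1%:R^-1) ^+ 2 @[n --> \oo] --> (0 : R).
    rewrite -[X in _ --> X](addr0 0); apply: cvgD; first exact: c1.
    rewrite -[X in _ --> X](expr0n _ 2) /=.
    apply: (cvg_comp (fun n : nat => n.+1%:R^-1 : R) (fun u : R => u ^+ 2)); first exact: cvg_harmonic.
    exact: exprn_continuous.
  apply: squeeze_cvgr (cvg_cst 0) cv; apply: nearW => n.
  rewrite Rintegral_ge0 //=.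
  have h1 := itg_abs (itgB ia (ian n)); have h2 := itg_abs (j1 n).
  have [_ ign _ /ltW h3] := gP n.
  apply: (@le_trans _ _ (\int[mu]_x (`|a x - an n x| + `|an n x - g n x|))).
    apply: Ritg_le; [exact/itg_abs/itgB|exact: itgD|].
    by move=> x; apply: le_trans (ler_normD _ _); rewrite addrA subrK.
  by rewrite RitgD // lerD2l.
Qed.

End Density.

(** * The Fourier integral and its inverse on integrable functions *)

Section ComplexFourier.
Context {R : realType}.
Local Notation mu := (@lebesgue_measure R).
Local Notation re := (@complex.Re R).
Local Notation im := (@complex.Im R).
Implicit Types (f g h : R -> R[i]) (a b c d : R -> R).

Lemma Ritg_odd a : itg a -> (forall x, a (- x) = - a x) -> \int[mu]_x a x = 0.
Proof.
move=> ia odda.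
have h : \int[mu]_x a x = \int[mu]_x a (- x).
  have mN : measurable_fun setT (-%R : measurableTypeR R -> measurableTypeR R).
    by apply: continuous_measurable_fun; exact: oppr_continuous.
  congr fine; rewrite -(@integral_pushforward _ _ (measurableTypeR R) (measurableTypeR R) R -%R mN mu setT (EFin \o a)) //.
  - by apply: eq_measure_integral => A mA _; exact/esym/lebesgue_measureN.
  - by apply/measurable_EFinP; exact: itg_measurable.
  - rewrite preimage_setT (_ : _ \o _ = (EFin \o (fun x => - 1 * a x))); first exact: itgZ.
    by apply/funext => x /=; rewrite odda mulN1r.
have : \int[mu]_x a x = - \int[mu]_x a x.
  rewrite {1}h -mulN1r -RitgZ //; apply: eq_Rintegral => x _.
  by rewrite odda mulN1r.
by move/eqP; rewrite -subr_eq0 opprK -mulr2n mulrn_eq0 => /eqP.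
Qed.

Lemma costrN a xi : costr a (- xi) = costr a xi.
Proof. by apply: eq_Rintegral => x _; rewrite mulrN cosN. Qed.

Lemma sintrN a xi : itg a -> sintr a (- xi) = - sintr a xi.
Proof.
move=> ia; rewrite -[RHS]mulN1r -RitgZ; last exact: itg_sin.
by apply: eq_Rintegral => x _; rewrite mulrN sinN; ring.
Qed.

Lemma costrB a b xi : itg a -> itg b ->
  costr (fun x => a x - b x) xi = costr a xi - costr b xi.
Proof.
move=> ia ib; rewrite /costr -RitgB; [|exact: itg_cos|exact: itg_cos].
by apply: eq_Rintegral => x _; rewrite mulrBl.
Qed.

Lemma sintrB a b xi : itg a -> itg b ->
  sintr (fun x => a x - b x) xi = sintr a xi - sintr b xi.
Proof.
move=> ia ib; rewrite /sintr -RitgB; [|exact: itg_sin|exact: itg_sin].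
by apply: eq_Rintegral => x _; rewrite mulrBl.
Qed.

Lemma costr_cvg (u : nat -> R -> R) a xi : (forall n, itg (u n)) -> itg a ->
  \int[mu]_x `|a x - u n x| @[n --> \oo] --> (0 : R) -> costr (u n) xi @[n --> \oo] --> costr a xi.
Proof.
move=> iu ia cv; apply/subr_cvg0/norm_cvg0P; apply: squeeze_cvgr (cvg_cst 0) cv; apply: nearW => n.
by rewrite normr_ge0 /= distrC -costrB //; apply: costr_bound; exact: itgB.
Qed.

Lemma sintr_cvg (u : nat -> R -> R) a xi : (forall n, itg (u n)) -> itg a ->
  \int[mu]_x `|a x - u n x| @[n --> \oo] --> (0 : R) -> sintr (u n) xi @[n --> \oo] --> sintr a xi.
Proof.
move=> iu ia cv; apply/subr_cvg0/norm_cvg0P; apply: squeeze_cvgr (cvg_cst 0) cv; apply: nearW => n.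
by rewrite normr_ge0 /= distrC -sintrB //; apply: sintr_bound; exact: itgB.
Qed.

Lemma costr_swap a c : itg a -> itg c ->
  \int[mu]_x (c x * costr a x) = \int[mu]_x (a x * costr c x).
Proof.
move=> ia ic.
have mk : measurable_fun setT (fun z : R * R => cos (2 * pi * z.2 * z.1)).
  apply: (measurableT_comp (f := @cos R)).
    by apply: continuous_measurable_fun; exact: continuous_cos.
  by apply: measurable_funM => //; exact: measurable_funM.
have h := itg_Fubini ic ia mk (fun z => cos_max _); apply: etrans h _.
by apply: eq_Rintegral => y _; congr (_ * _); apply: eq_Rintegral => x _; rewrite /= mulrAC.
Qed.

Lemma sintr_swap a c : itg a -> itg c ->
  \int[mu]_x (c x * sintr a x) = \int[mu]_x (a x * sintr c x).
Proof.
move=> ia ic.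
have mk : measurable_fun setT (fun z : R * R => sin (2 * pi * z.2 * z.1)).
  apply: (measurableT_comp (f := @sin R)).
    by apply: continuous_measurable_fun; exact: continuous_sin.
  by apply: measurable_funM => //; exact: measurable_funM.
have h := itg_Fubini ic ia mk (fun z => sin_max _); apply: etrans h _.
by apply: eq_Rintegral => y _; congr (_ * _); apply: eq_Rintegral => x _; rewrite /= mulrAC.
Qed.

Lemma itg_mul_costr a c : itg a -> itg c -> itg (fun x => c x * costr a x).
Proof.
move=> ia ic; apply: (itgM ic _ (fun x => costr_bound x ia)).
by apply: continuous_measurable_fun; exact: continuous_costr.
Qed.

Lemma itg_mul_sintr a c : itg a -> itg c -> itg (fun x => c x * sintr a x).
Proof.
move=> ia ic; apply: (itgM ic _ (fun x => sintr_bound x ia)).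
by apply: continuous_measurable_fun; exact: continuous_sintr.
Qed.

(* The Fourier integral for [s = 1], its inverse for [s = -1]. *)
Definition FT (s : R) f (xi : R) : R[i] :=
  Complex (costr (re \o f) xi + s * sintr (im \o f) xi)
          (costr (im \o f) xi - s * sintr (re \o f) xi).

Lemma fourier_integralE f : inLp 1%:E f -> fourier_integral f = FT 1 f.
Proof.
move=> /inLp1P[i1 i2]; apply/funext => xi; rewrite /fourier_integral /cintegral /FT !mul1r.
rewrite /costr /sintr -RitgD; [|exact: itg_cos|exact: itg_sin].
rewrite -RitgB; [|exact: itg_cos|exact: itg_sin].
congr Complex; apply: eq_Rintegral => x _; rewrite /cis cosN sinN /=; case: (f x) => p q /=;
by rewrite ?mulrN ?opprK // addrC.
Qed.

Lemma inv_fourier_integralE f : inLp 1%:E f -> inv_fourier_integral f = FT (- 1) f.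
Proof.
move=> /inLp1P[i1 i2]; apply/funext => xi; rewrite /inv_fourier_integral /cintegral /FT !mulN1r opprK.
rewrite /costr /sintr -RitgD; [|exact: itg_cos|exact: itg_sin].
rewrite -RitgB; [|exact: itg_cos|exact: itg_sin].
by congr Complex; apply: eq_Rintegral => x _; rewrite /cis /= (mulrAC _ xi x); case: (f x) => p q /=; ring.
Qed.

Lemma inLp1B f g : inLp 1%:E f -> inLp 1%:E g -> inLp 1%:E (f \- g).
Proof.
move=> /inLp1P[f1 f2] /inLp1P[g1 g2]; apply/inLp1P; split.
  rewrite (_ : re \o _ = (fun x => (re \o f) x - (re \o g) x)); first exact: itgB.
  by apply/funext => x /=; rewrite reB.
rewrite (_ : im \o _ = (fun x => (im \o f) x - (im \o g) x)); first exact: itgB.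
by apply/funext => x /=; rewrite imB.
Qed.

Lemma FTB s f g : inLp 1%:E f -> inLp 1%:E g -> FT s (f \- g) = FT s f \- FT s g.
Proof.
move=> /inLp1P[f1 f2] /inLp1P[g1 g2]; apply/funext => xi; rewrite /FT.
have -> : re \o (f \- g) = (fun x => (re \o f) x - (re \o g) x) by apply/funext => x /=; rewrite reB.
have -> : im \o (f \- g) = (fun x => (im \o f) x - (im \o g) x) by apply/funext => x /=; rewrite imB.
rewrite !costrB // !sintrB //.
apply/eqP; rewrite eq_complex /=; apply/andP; split; apply/eqP.
  by ring.
by ring.
Qed.

Lemma continuous_re_FT s f : inLp 1%:E f -> continuous (re \o FT s f).
Proof.
move=> /inLp1P[f1 f2] x; apply: cvgD; first exact: continuous_costr.
by apply: cvgM; [exact: cvg_cst|exact: continuous_sintr].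
Qed.

Lemma continuous_im_FT s f : inLp 1%:E f -> continuous (im \o FT s f).
Proof.
move=> /inLp1P[f1 f2] x; apply: cvgB; first exact: continuous_costr.
by apply: cvgM; [exact: cvg_cst|exact: continuous_sintr].
Qed.

Definition nice f := [/\ continuous (re \o f), continuous (im \o f), inLp 1%:E f &
  exists M : R, forall x, `|re (f x)| <= M /\ `|im (f x)| <= M].

Lemma itg_sqr a (M : R) : itg a -> (forall x, `|a x| <= M) -> itg (fun x => a x ^+ 2).
Proof.
by move=> ia aM; have := itgM ia (itg_measurable ia) aM; under eq_fun do rewrite -expr2.
Qed.

Lemma inLp2_Complex a b : measurable_fun setT a -> measurable_fun setT b ->
  itg (fun x => a x ^+ 2) -> itg (fun x => b x ^+ 2) -> inLp 2%:E (fun x => Complex (a x) (b x)).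
Proof.
move=> ma mb ia ib; split; apply: Lfun2I => //; rewrite /= -EFin_Ritg ?ltry //.
Qed.

Lemma nice_inLp2 f : nice f -> inLp 2%:E f.
Proof.
move=> [c1 c2 /inLp1P[i1 i2] [M fM]].
have -> : f = fun x => Complex ((re \o f) x) ((im \o f) x) by apply/funext => x /=; case: (f x).
apply: inLp2_Complex; [exact: continuous_measurable_fun|exact: continuous_measurable_fun| |].
  by apply: (itg_sqr (M := M)) => // x; case: (fM x).
by apply: (itg_sqr (M := M)) => // x; case: (fM x).
Qed.

Lemma sqr_tr a (M : R) : continuous a -> itg a -> (forall x, `|a x| <= M) ->
  itg (fun xi => costr a xi ^+ 2 + sintr a xi ^+ 2) /\
  \int[mu]_xi (costr a xi ^+ 2 + sintr a xi ^+ 2) = \int[mu]_x (a x ^+ 2).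
Proof.
move=> ca ia aM; apply: ge0_itg.
- move=> xi; apply: cvgD.
    apply: (cvg_comp (costr a) (fun u : R => u ^+ 2)); first exact: continuous_costr.
    exact: exprn_continuous.
  apply: (cvg_comp (sintr a) (fun u : R => u ^+ 2)); first exact: continuous_sintr.
  exact: exprn_continuous.
- by move=> xi; rewrite addr_ge0 ?sqr_ge0.
- exact: real_plancherel aM.
Qed.

Lemma normr_mul_le (u v : R) : `|u * v| <= u ^+ 2 + v ^+ 2.
Proof.
have := sqr_ge0 (u + v); have := sqr_ge0 (u - v); have := sqr_ge0 u; have := sqr_ge0 v.
by rewrite ler_norml !expr2 => *; apply/andP; split; lra.
Qed.

Lemma limn_einf_cvg (u : nat -> \bar R) (l : \bar R) : u n @[n --> \oo] --> l -> limn_einf u = l.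
Proof.
move=> ul; rewrite is_cvg_limn_einfE; first exact/cvg_lim.
by apply/cvg_ex; exists l.
Qed.

(** With [a], [b] the real and imaginary parts of [f], the squared modulus of the transform is the
    sum of the squares belonging to [a] and [b] plus a multiple of
    [costr a * sintr b - costr b * sintr a]. Cosine transforms are even and sine transforms odd, so
    the mixed term is odd and integrates to zero. *)
Lemma plancherel_nice s f : s ^+ 2 = 1 -> nice f ->
  inLp 2%:E (FT s f) /\ ip (FT s f) (FT s f) = ip f f.
Proof.
move=> s1 nf; have [c1 c2 l1f [M fM]] := nf; have /inLp1P[i1 i2] := l1f.
have [ja va] := sqr_tr c1 i1 (fun x => proj1 (fM x)).
have [jb vb] := sqr_tr c2 i2 (fun x => proj2 (fM x)).
set a := re \o f in c1 i1 ja va *; set b := im \o f in c2 i2 jb vb *.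
have mcr (p : R -> R) : itg p -> measurable_fun setT (costr p).
  by move=> ?; apply: continuous_measurable_fun; exact: continuous_costr.
have msr (p : R -> R) : itg p -> measurable_fun setT (sintr p).
  by move=> ?; apply: continuous_measurable_fun; exact: continuous_sintr.
have jc : itg (fun xi => costr a xi * sintr b xi - costr b xi * sintr a xi).
  apply: (itg_le (b := fun xi => (costr a xi ^+ 2 + sintr a xi ^+ 2) + (costr b xi ^+ 2 + sintr b xi ^+ 2))).
  - by apply: measurable_funB; apply: measurable_funM; [exact: mcr|exact: msr|exact: mcr|exact: msr].
  - exact: itgD.
  - move=> xi; apply: le_trans (ler_normB _ _) _.
    apply: (@le_trans _ _ ((costr a xi ^+ 2 + sintr b xi ^+ 2) + (costr b xi ^+ 2 + sintr a xi ^+ 2))).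
      by apply: lerD; exact: normr_mul_le.
    by rewrite [leLHS]addrACA [leRHS]addrACA lerD2l addrC.
have vc : \int[mu]_xi (costr a xi * sintr b xi - costr b xi * sintr a xi) = 0.
  by apply: Ritg_odd jc _ => xi; rewrite !costrN !sintrN //; ring.
have E xi : cdot (FT s f xi) (FT s f xi) = ((costr a xi ^+ 2 + sintr a xi ^+ 2) + (costr b xi ^+ 2 + sintr b xi ^+ 2))
    + 2 * s * (costr a xi * sintr b xi - costr b xi * sintr a xi).
  rewrite /cdot /FT /= -/a -/b.
  move: (costr a xi) (sintr b xi) (costr b xi) (sintr a xi) => p q r t.
  rewrite (_ : _ + _ = p ^+ 2 + r ^+ 2 + s ^+ 2 * (q ^+ 2 + t ^+ 2) + 2 * s * (p * q - r * t)); last by ring.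
  by rewrite s1; ring.
have j : itg (fun xi => cdot (FT s f xi) (FT s f xi)).
  by under eq_fun do rewrite E; apply: itgD; [exact: itgD|exact: itgZ].
have l2 : inLp 2%:E (FT s f).
  apply: inLp2I.
  - by apply: continuous_measurable_fun; exact: continuous_re_FT.
  - by apply: continuous_measurable_fun; exact: continuous_im_FT.
  - by rewrite -EFin_Ritg ?ltry.
split => //; rewrite /ip; under eq_Rintegral do rewrite E.
rewrite (RitgD (itgD ja jb) (itgZ _ jc)) (RitgD ja jb) (RitgZ _ jc) vc mulr0 addr0 va vb.
rewrite -RitgD //.
- by apply: (itg_sqr i1) => x; exact: (proj1 (fM x)).
- by apply: (itg_sqr i2) => x; exact: (proj2 (fM x)).
Qed.


Lemma dense_nice f : inLp 2%:E f -> exists g : nat -> R -> R[i],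
  [/\ forall n, nice (g n), nrm (f \- g n) @[n --> \oo] --> (0 : R) &
    inLp 1%:E f -> forall s xi,
      re (FT s (g n) xi) @[n --> \oo] --> re (FT s f xi) /\
      im (FT s (g n) xi) @[n --> \oo] --> im (FT s f xi)].
Proof.
move=> f2; have [mr mi] := inLp_measurable f2.
have [/Lfun2_integrable_sqr ir /Lfun2_integrable_sqr ii] := f2.
have [p [pP p2 pc pc1]] := dense_real mr ir.
have [q [qP q2 qc qc1]] := dense_real mi ii.
pose g n x := Complex (p n x) (q n x).
have l1g n : inLp 1%:E (g n).
  by apply/inLp1P; split; [case: (pP n)|case: (qP n)].
exists g; split.
- move=> n; have [cp ip1 [M1 pM]] := pP n; have [cq iq1 [M2 qM]] := qP n.
  split => //; exists (Num.max M1 M2) => x.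
  by split; [apply: le_trans (pM x) _|apply: le_trans (qM x) _]; rewrite le_max lexx ?orbT.
- have sq : ip (f \- g n) (f \- g n) @[n --> \oo] --> (0 : R).
    have -> : (fun n => ip (f \- g n) (f \- g n)) = (fun n => \int[mu]_x ((re \o f) x - p n x) ^+ 2 + \int[mu]_x ((im \o f) x - q n x) ^+ 2).
      apply/funext => n; rewrite -RitgD //; apply: eq_Rintegral => x _.
      by rewrite /cdot reB imB !expr2.
    by rewrite -[X in _ --> X](addr0 0); exact: cvgD.
  by rewrite -[X in _ --> X]sqrtr0; apply: (cvg_comp (fun n => ip (f \- g n) (f \- g n)) Num.sqrt) sq _; exact: sqrt_continuous.
- move=> /inLp1P[i1 i2] s xi.
  have {}pc1 := pc1 i1; have {}qc1 := qc1 i2.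
  have ip1 n : itg (p n) by case: (pP n). have iq1 n : itg (q n) by case: (qP n).
  split.
    apply: cvgD; first exact: costr_cvg.
    by apply: cvgM; [exact: cvg_cst|exact: sintr_cvg].
  apply: cvgB; first exact: costr_cvg.
  by apply: cvgM; [exact: cvg_cst|exact: sintr_cvg].
Qed.

(** Fatou's lemma along transforms of nice approximations, which converge pointwise. It yields
    membership in L2 and one inequality, enough to extend the equality by continuity afterwards. *)
Lemma FT_contraction s f : s ^+ 2 = 1 -> inLp 1%:E f -> inLp 2%:E f ->
  inLp 2%:E (FT s f) /\ nrm (FT s f) <= nrm f.
Proof.
move=> s1 f1 f2; have [g [ng gc gp]] := dense_nice f2.
have {}gp := gp f1 s.
have mr h : inLp 1%:E h -> measurable_fun setT (re \o FT s h).
  by move=> ?; apply: continuous_measurable_fun; exact: continuous_re_FT.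
have mi h : inLp 1%:E h -> measurable_fun setT (im \o FT s h).
  by move=> ?; apply: continuous_measurable_fun; exact: continuous_im_FT.
have md h : inLp 1%:E h -> measurable_fun setT (fun x => (cdot (FT s h x) (FT s h x))%:E).
  move=> h1; apply/measurable_EFinP.
  exact: measurable_funD (measurable_funM (mr _ h1) (mr _ h1)) (measurable_funM (mi _ h1) (mi _ h1)).
have g1 n : inLp 1%:E (g n) by case: (ng n).
have g2 n : inLp 2%:E (g n) by exact: nice_inLp2.
have ft := @fatou _ _ R mu setT measurableT (fun n x => (cdot (FT s (g n) x) (FT s (g n) x))%:E) (fun n => md _ (g1 n)) _.
have {ft} ft : (\int[mu]_x (cdot (FT s f x) (FT s f x))%:E <= (ip f f)%:E)%E.
  have <- : limn_einf (fun n => \int[mu]_x (cdot (FT s (g n) x) (FT s (g n) x))%:E)%E = (ip f f)%:E.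
    apply: limn_einf_cvg.
    have -> : (fun n => \int[mu]_x (cdot (FT s (g n) x) (FT s (g n) x))%:E)%E = (fun n => (nrm (g n) ^+ 2)%:E).
      apply/funext => n; have [l2 e] := plancherel_nice s1 (ng n).
      by rewrite -EFin_ip // e nrm_sqr.
    apply/fine_cvgP; split; first exact: nearW.
    rewrite -nrm_sqr; apply: (cvg_comp (fun n => nrm (g n)) (fun u : R => u ^+ 2)); last exact: exprn_continuous.
    by apply: nrm_cvg => //; under eq_fun do rewrite nrm_distC.
  have <- : (\int[mu]_x limn_einf (fun n => (cdot (FT s (g n) x) (FT s (g n) x))%:E) = \int[mu]_x (cdot (FT s f x) (FT s f x))%:E)%E.
    apply: eq_integral => x _; apply: limn_einf_cvg.
    apply/fine_cvgP; split; first exact: nearW.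
    by have [c1 c2] := gp x; apply: cvgD; apply: cvgM.
  by apply: ft => n x _; rewrite lee_fin cdot_ge0.
have l2 : inLp 2%:E (FT s f).
  by apply: inLp2I; [exact: mr|exact: mi|exact: le_lt_trans ft (ltry _)].
split => //; rewrite -(@ler_pXn2r _ 2) // ?nnegrE ?nrm_ge0 // !nrm_sqr.
by move: ft; rewrite -EFin_ip.
Qed.

(** Contraction applied to [f \- g n] makes the transforms of the nice functions [g n] converge in
    L2, so their norm equality passes to the limit. *)
Lemma plancherel s f : s ^+ 2 = 1 -> inLp 1%:E f -> inLp 2%:E f -> nrm (FT s f) = nrm f.
Proof.
move=> s1 f1 f2; have [g [ng gc _]] := dense_nice f2.
have g1 n : inLp 1%:E (g n) by case: (ng n).
have g2 n : inLp 2%:E (g n) by exact: nice_inLp2.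
have [Ff2 _] := FT_contraction s1 f1 f2.
have cg : nrm (g n) @[n --> \oo] --> nrm f.
  by apply: nrm_cvg => //; under eq_fun do rewrite nrm_distC.
apply: cvg_unique cg => //.
have -> : (fun n => nrm (g n)) = (fun n => nrm (FT s (g n))).
  by apply/funext => n; have [_ e] := plancherel_nice s1 (ng n); rewrite /nrm e.
apply: nrm_cvg => //; first by move=> n; have [] := plancherel_nice s1 (ng n).
apply: squeeze_cvgr (cvg_cst 0) gc; apply: nearW => n.
rewrite nrm_ge0 /= nrm_distC -FTB //.
have [] := @FT_contraction s (f \- g n) s1 => //; first exact: inLp1B.
exact: inLp2B.
Qed.

(** Fubini on the four real products. The sign changes because [cdot] is the real part of a product
    with one factor conjugated. *)
Lemma FT_adjoint s f g : inLp 1%:E f -> inLp 1%:E g ->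
  ip (FT s f) g = ip f (FT (- s) g).
Proof.
move=> /inLp1P[i1 i2] /inLp1P[j1 j2]; rewrite /ip.
set a := re \o f in i1 *; set b := im \o f in i2 *; set c := re \o g in j1 *; set d := im \o g in j2 *.
have cE (u v : R -> R) : itg u -> itg v -> itg (fun x => v x * costr u x) by exact: itg_mul_costr.
have sE r (u v : R -> R) : itg u -> itg v -> itg (fun x => r * (v x * sintr u x)).
  by move=> *; apply: itgZ; exact: itg_mul_sintr.
transitivity (\int[mu]_x ((c x * costr a x + s * (c x * sintr b x)) + (d x * costr b x + (- s) * (d x * sintr a x)))).
  by apply: eq_Rintegral => x _; rewrite /cdot /FT /= -/a -/b /c /d /=; ring.
transitivity (\int[mu]_x ((a x * costr c x + (- s) * (a x * sintr d x)) + (b x * costr d x + s * (b x * sintr c x)))); last first.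
  by apply: eq_Rintegral => x _; rewrite /cdot /FT /= -/c -/d /a /b /=; ring.
rewrite (RitgD (itgD (cE _ _ i1 j1) (sE s _ _ i2 j1)) (itgD (cE _ _ i2 j2) (sE (- s) _ _ i1 j2))).
rewrite (RitgD (itgD (cE _ _ j1 i1) (sE (- s) _ _ j2 i1)) (itgD (cE _ _ j2 i2) (sE s _ _ j1 i2))).
rewrite (RitgD (cE _ _ i1 j1) (sE s _ _ i2 j1)) (RitgD (cE _ _ i2 j2) (sE (- s) _ _ i1 j2)).
rewrite (RitgD (cE _ _ j1 i1) (sE (- s) _ _ j2 i1)) (RitgD (cE _ _ j2 i2) (sE s _ _ j1 i2)).
rewrite (RitgZ s (itg_mul_sintr i2 j1)) (RitgZ (- s) (itg_mul_sintr i1 j2)).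
rewrite (RitgZ (- s) (itg_mul_sintr j2 i1)) (RitgZ s (itg_mul_sintr j1 i2)).
have gen (x1 x2 x3 x4 y1 y2 y3 y4 : R) : x1 = y1 -> x2 = y2 -> x3 = y3 -> x4 = y4 ->
  x1 + s * x2 + (x3 + - s * x4) = y1 + - s * y4 + (y3 + s * y2) by move=> -> -> -> ->; ring.
exact: (gen _ _ _ _ _ _ _ _ (costr_swap i1 j1) (sintr_swap i2 j1) (costr_swap i2 j2) (sintr_swap i1 j2)).
Qed.

End ComplexFourier.

(** * The Fourier transform on L2 *)

Section L2Fourier.
Context {R : realType}.
Local Notation mu := (@lebesgue_measure R).
Local Notation re := (@complex.Re R).
Local Notation im := (@complex.Im R).
Implicit Types (s : R) (f g h : R -> R[i]).

(** [L2_extension] restated with the real-valued norm [nrm], for both signs at once. *)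
Definition L2FT s f g : Prop :=
  [/\ inLp 2%:E f, inLp 2%:E g &
      exists u : nat -> R -> R[i],
        [/\ forall n, inLp 1%:E (u n) /\ inLp 2%:E (u n),
            nrm (u n \- f) @[n --> \oo] --> (0 : R) &
            nrm (FT s (u n) \- g) @[n --> \oo] --> (0 : R)]].

Lemma L2norm_cvg0 (u : nat -> R -> R[i]) f : (forall n, inLp 2%:E (u n)) -> inLp 2%:E f ->
  L2norm setT (u n \- f) @[n --> \oo] --> 0%E <-> nrm (u n \- f) @[n --> \oo] --> (0 : R).
Proof.
move=> u2 f2; have -> : (fun n => L2norm setT (u n \- f)) = (fun n => (nrm (u n \- f))%:E).
  by apply/funext => n; rewrite L2normT //; exact: inLp2B.
split=> [h|h]; first exact: fine_cvg h.
by apply/fine_cvgP; split; [exact: nearW|exact: h].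
Qed.

Lemma L2_extension_L2FT (T : (R -> R[i]) -> R -> R[i]) s f g : s ^+ 2 = 1 ->
  (forall u, inLp 1%:E u -> T u = FT s u) -> L2_extension T f g <-> L2FT s f g.
Proof.
move=> s1 TE; split=> -[f2 g2 [u [u12 uf Tug]]]; split => //; exists u; split => //.
- by apply/L2norm_cvg0 => // n; case: (u12 n).
- move: Tug; have -> : (fun n => L2norm setT (T (u n) \- g)) = (fun n => L2norm setT (FT s (u n) \- g)).
    by apply/funext => n; rewrite TE //; case: (u12 n).
  by move/L2norm_cvg0; apply => // n; have [a b] := u12 n; have [] := FT_contraction s1 a b.
- by apply/L2norm_cvg0 => // n; case: (u12 n).
- have -> : (fun n => L2norm setT (T (u n) \- g)) = (fun n => L2norm setT (FT s (u n) \- g)).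
    by apply/funext => n; rewrite TE //; case: (u12 n).
  by apply/L2norm_cvg0 => // n; have [a b] := u12 n; have [] := FT_contraction s1 a b.
Qed.

Lemma is_fourierP f g : is_fourier f g <-> L2FT 1 f g.
Proof. by apply: L2_extension_L2FT; [exact: expr1n|exact: fourier_integralE]. Qed.

Lemma is_inv_fourierP f g : is_inv_fourier f g <-> L2FT (- 1) f g.
Proof. by apply: L2_extension_L2FT; [rewrite sqrrN expr1n|exact: inv_fourier_integralE]. Qed.

Section sign.
Context (s : R) (s1 : s ^+ 2 = 1).

Lemma FT_inLp2 f : inLp 1%:E f -> inLp 2%:E f -> inLp 2%:E (FT s f).
Proof. by move=> f1 f2; have [] := FT_contraction s1 f1 f2. Qed.

Lemma L2FT_isometry f g : L2FT s f g -> nrm g = nrm f.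
Proof.
move=> [f2 g2 [u [u12 uf ug]]].
have u2 n : inLp 2%:E (u n) by case: (u12 n).
have Fu2 n : inLp 2%:E (FT s (u n)) by have [? ?] := u12 n; exact: FT_inLp2.
have c1 := nrm_cvg u2 f2 uf; have := nrm_cvg Fu2 g2 ug.
have -> : (fun n => nrm (FT s (u n))) = (fun n => nrm (u n)).
  by apply/funext => n; have [? ?] := u12 n; exact: plancherel.
by move=> c2; apply: cvg_unique c2 c1.
Qed.

Lemma L2FT_unique f g h : L2FT s f g -> L2FT s f h -> {ae mu, forall x, g x = h x}.
Proof.
move=> [f2 g2 [u [u12 uf ug]]] [_ h2 [v [v12 vf vg]]].
have u2 n : inLp 2%:E (u n) by case: (u12 n).
have v2 n : inLp 2%:E (v n) by case: (v12 n).
have Fu2 n : inLp 2%:E (FT s (u n)) by have [? ?] := u12 n; exact: FT_inLp2.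
have Fv2 n : inLp 2%:E (FT s (v n)) by have [? ?] := v12 n; exact: FT_inLp2.
have n0 : nrm (g \- h) = 0.
  (* The path from [g] to [h] goes through the transforms of [u n] and [v n], whose distance is that
     of [u n] and [v n] by Plancherel. *)
  pose B n := (nrm (FT s (u n) \- g) + (nrm (u n \- f) + nrm (v n \- f))) + nrm (FT s (v n) \- h).
  have cB : B n @[n --> \oo] --> (0 : R).
    rewrite -[X in _ --> X](addr0 0) -[X in _ --> X + _](addr0 0) -[X in _ --> _ + X + _](addr0 0).
    by do ![apply: cvgD => //].
  suff cc : nrm (g \- h) @[_ --> \oo] --> (0 : R) by apply: cvg_unique (cvg_cst _) cc.
  apply: squeeze_cvgr (cvg_cst 0) cB; apply: nearW => n.
  rewrite nrm_ge0 /=; apply: le_trans (nrm_triangle g2 (Fv2 n) h2) _; rewrite /B lerD2r.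
  apply: le_trans (nrm_triangle g2 (Fu2 n) (Fv2 n)) _; rewrite (nrm_distC g) lerD2l.
  have [a1 a2] := u12 n; have [b1 b2] := v12 n.
  rewrite -FTB // plancherel //; [|exact: inLp1B|exact: inLp2B].
  by apply: le_trans (nrm_triangle a2 f2 b2) _; rewrite (nrm_distC f).
have := nrm_eq0_ae (inLp2B g2 h2) n0.
by apply: ae_imply => x /= /eqP; rewrite subr_eq0 => /eqP.
Qed.

(** For nice [v n] tending to [g], expanding squares shows that [FT (- s) (v n)] is exactly as far
    from [f] as [v n] is from [g]: the norms agree by Plancherel and isometry, the cross terms by
    [FT_adjoint] along the sequence [u] that defines [g]. *)
Lemma L2FT_inverse f g : L2FT s f g -> L2FT (- s) g f.
Proof.
move=> fg; have iso := L2FT_isometry fg; have [f2 g2 [u [u12 uf ug]]] := fg.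
have s1' : (- s) ^+ 2 = 1 by rewrite sqrrN.
split => //; have [v [nv vc _]] := dense_nice g2.
have v1 n : inLp 1%:E (v n) by case: (nv n).
have v2 n : inLp 2%:E (v n) by exact: nice_inLp2.
have u1 n : inLp 1%:E (u n) by case: (u12 n).
have u2 n : inLp 2%:E (u n) by case: (u12 n).
have Fu2 n : inLp 2%:E (FT s (u n)) by exact: FT_inLp2.
have Fv2 n : inLp 2%:E (FT (- s) (v n)) by have [] := FT_contraction s1' (v1 n) (v2 n).
exists v; split => //; first by under eq_fun do rewrite nrm_distC.
have -> : (fun n => nrm (FT (- s) (v n) \- f)) = (fun n => nrm (g \- v n)); last exact: vc.
apply/funext => n; rewrite (nrm_distC g); congr Num.sqrt; rewrite !ipBB //.
congr (_ + _); last by rewrite -!nrm_sqr iso.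
congr (_ - 2 * _).
  by rewrite -!nrm_sqr plancherel.
have c1 := ip_cvg u2 f2 (Fv2 n) uf.
have c2 := ip_cvg Fu2 g2 (v2 n) ug.
have E : (fun m => ip (FT (- s) (v n)) (u m)) = (fun m => ip (v n) (FT s (u m))).
  by apply/funext => m; rewrite FT_adjoint // opprK.
by rewrite E in c1; apply: cvg_unique c1 c2.
Qed.

End sign.

Lemma L2FT_FT s f : s ^+ 2 = 1 -> inLp 1%:E f -> inLp 2%:E f -> L2FT s f (FT s f).
Proof.
move=> s1 f1 f2; have Ff2 := FT_inLp2 s1 f1 f2.
have z h : nrm (h \- h) = 0.
  rewrite /nrm /ip -[RHS]sqrtr0; congr Num.sqrt.
  under eq_Rintegral do rewrite /cdot reB imB !subrr !mul0r addr0.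
  by rewrite Rintegral_cst // mul0r.
by split => //; exists (fun=> f); split => //; rewrite z; exact: cvg_cst.
Qed.

Lemma L2FT_ae s f g h : L2FT s f h -> inLp 2%:E g -> {ae mu, forall x, f x = g x} -> L2FT s g h.
Proof.
move=> [f2 h2 [u [u12 uf ug]]] g2 fg; split => //; exists u; split => //.
have -> : (fun n => nrm (u n \- g)) = (fun n => nrm (u n \- f)) => //.
apply/funext => n; have [_ un2] := u12 n; apply: nrm_ae; [exact: inLp2B|exact: inLp2B|].
by apply: ae_imply fg => x /= ->.
Qed.

End L2Fourier.

(** * Interpolation on well-spaced points *)

Section Interpolation.
Context {R : realType}.
Implicit Types (f df : R -> R) (p q x y : R).

Lemma is_derive_continuous f df : (forall x : R, is_derive x 1 f (df x)) -> continuous f.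
Proof.
by move=> dF x; apply/differentiable_continuous/derivable1_diffP; have [] := dF x.
Qed.

(** The new zeros stay above [x0] and below [q], so that the iteration ends with a zero in the
    original interval. *)
Lemma Rolle_path f df (t : seq R) (x0 q : R) : (forall x : R, is_derive x 1 f (df x)) ->
  path <%R x0 t -> all (fun x => f x == 0) (x0 :: t) -> all (fun x => x <= q) (x0 :: t) ->
  exists s : seq R, [/\ size s = size t, path <%R x0 s, all (fun x => df x == 0) s &
    all (fun x => x <= q) s].
Proof.
move=> dF; elim: t x0 => [|x1 t IH] x0; first by exists [::].
move=> /= /andP[x01 pt] /andP[/eqP f0 ft] /andP[_ qt].
have [s [ss ps ds qs]] := IH x1 pt ft qt.
have cF := is_derive_continuous dF.
have /= /andP[/eqP f1 _] := ft.
have [|||c cin dc] := @Rolle R f x0 x1 x01 _ _ _.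
- by move=> x _; have [] := dF x.
- exact: continuous_subspaceT.
- by rewrite f0 f1.
move: cin; rewrite in_itv /= => /andP[x0c cx1].
exists (c :: s); split => /=.
- by rewrite ss.
- rewrite x0c /=; case: s {ss ds qs} ps => //= y s /andP[x1y ->].
  by rewrite (lt_trans cx1).
- rewrite ds andbT; have [_ h1] := dF c; have [_ h2] := dc.
  by rewrite -h1 h2.
- by rewrite qs andbT; have /= /andP[h _] := qt; rewrite (le_trans (ltW cx1)).
Qed.

Lemma iterated_Rolle (D : nat -> R -> R) n (x0 q : R) (t : seq R) :
  (forall k (x : R), is_derive x 1 (D k) (D k.+1 x)) -> size t = n ->
  path <%R x0 t -> all (fun x => D 0 x == 0) (x0 :: t) -> all (fun x => x <= q) (x0 :: t) ->
  exists2 xi, x0 <= xi <= q & D n xi = 0.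
Proof.
elim: n D x0 t => [|n IH] D x0 t dD st pt zt qt.
  exists x0; last by have /= /andP[/eqP] := zt.
  by have /= /andP[-> _] := qt; rewrite lexx.
have [s [ss ps ds qs]] := Rolle_path (dD 0) pt zt qt.
case: s ss ps ds qs => [|y s] ss ps ds qs; first by rewrite st in ss.
have /= /andP[x0y ys] := ps.
have [|xi /andP[h1 h2] h3] := IH (fun k => D k.+1) y s (fun k x => dD k.+1 x) _ ys ds qs.
  by move: ss; rewrite st => -[].
by exists xi => //; rewrite h2 (le_trans (ltW x0y)).
Qed.

(** Subtract from [D 0] the interpolant and the multiple of the nodal polynomial [W] that creates a
    further zero at [y]. The difference [G 0] has [n + 1] zeros, so its [n]-th derivative vanishes
    somewhere. *)
Lemma interpolation_error (D : nat -> R -> R) n (x : nat -> R) (P : {poly R}) (p q y : R) :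
  (forall k (z : R), is_derive z 1 (D k) (D k.+1 z)) ->
  (forall i, (i < n)%N -> p <= x i <= q) ->
  (forall i j, (i < j < n)%N -> x i < x j) -> p <= y <= q -> (size P <= n)%N ->
  (forall i, (i < n)%N -> P.[x i] = D 0 (x i)) ->
  exists2 xi, p <= xi <= q & D 0 y - P.[y] = D n xi / n`!%:R * \prod_(i < n) (y - x i).
Proof.
move=> dD xpq xinc ypq sP Px.
(* At a node both sides vanish, whatever [xi] is. *)
have [[i [lin yx]]|ynx] := pselect (exists i, (i < n)%N /\ y = x i).
  exists y => //; rewrite (bigD1 (Ordinal lin)) //= yx subrr mul0r mulr0.
  by rewrite Px // subrr.
pose W : {poly R} := \prod_(i < n) ('X - (x i)%:P).
have Wy : W.[y] = \prod_(i < n) (y - x i).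
  by rewrite horner_prod; apply: eq_bigr => i _; rewrite hornerXsubC.
have W0 : W.[y] != 0.
  rewrite Wy; apply/prodf_neq0 => i _; rewrite subr_eq0; apply/eqP => yx.
  by apply: ynx; exists i.
pose K := (D 0 y - P.[y]) / W.[y].
pose Q := P + K *: W.
pose G k z := D k z - (Q^`(k)).[z].
have dG k z : is_derive (z : R) 1 (G k) (G k.+1 z).
  by rewrite /G derivnS; apply: is_deriveB.
have sW : size W = n.+1.
  by rewrite /W size_prod_XsubC /index_enum -enumT size_enum_ord.
have mW : W \is monic by exact: monic_prod_XsubC.
have zx i : (i < n)%N -> G 0 (x i) = 0.
  move=> lin; rewrite /G derivn0 /Q hornerD hornerZ Px // horner_prod (bigD1 (Ordinal lin)) //=.
  by rewrite hornerXsubC subrr mul0r mulr0 addr0 subrr.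
have zy : G 0 y = 0.
  by rewrite /G derivn0 /Q hornerD hornerZ /K divfK // opprD addrA subrr.
(* Rolle needs the zeros in increasing order, and [y] may fall anywhere among the nodes. *)
pose s := sort <=%R (y :: [seq x i | i <- iota 0 n]).
have us : uniq s.
  rewrite sort_uniq /=; apply/andP; split.
    apply/mapP => -[k]; rewrite mem_iota /= add0n => lin yx.
    by apply: ynx; exists k.
  rewrite map_inj_in_uniq ?iota_uniq // => i j; rewrite !mem_iota /= !add0n => lin ljn xij.
  case: (ltngtP i j) => // ij; [have := xinc i j|have := xinc j i];
  by rewrite ij ?lin ?ljn xij ltxx => /(_ isT).
have ms z : z \in s -> G 0 z == 0 /\ p <= z <= q.
  rewrite mem_sort inE => /orP[/eqP ->|/mapP[k]]; first by rewrite zy.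
  by rewrite mem_iota /= add0n => lin ->; rewrite zx // eqxx; split => //; exact: xpq.
have ssz : size s = n.+1 by rewrite size_sort /= size_map size_iota.
have sS : sorted <%R s by rewrite lt_sorted_uniq_le us sort_le_sorted.
case: s us ms ssz sS => // x0 t us ms [st] /= pt.
have [||xi /andP[h1 h2] h3] := @iterated_Rolle G n x0 q t dG st pt.
- by apply/allP => z /ms[].
- by apply/allP => z /ms[_ /andP[]].
exists xi.
  by rewrite h2 andbT (le_trans _ h1) //; have [|_ /andP[]] := ms x0; rewrite ?inE ?eqxx.
(* [P] has degree below [n] and [W] is monic of degree [n], so only the leading term of [K *: W]
   survives. *)
have Qn : Q^`(n) = (K * n`!%:R)%:P.
  rewrite /Q derivnD derivnZ (derivn_poly0 sP) add0r.
  have -> : W^`(n) = (n`!%:R)%:P; last by rewrite polyCM mul_polyC.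
  apply/polyP => i; rewrite coef_derivn coefC; case: i => [|i] /=.
    by rewrite addn0 ffactnn; have := mW; rewrite monicE lead_coefE sW /= => /eqP ->.
  by rewrite nth_default ?mul0rn // sW addnS ltnS leq_addr.
move: h3; rewrite /G Qn hornerC => /eqP; rewrite subr_eq0 => /eqP ->.
have f0 : (n`!%:R : R) != 0 by rewrite pnatr_eq0 -lt0n fact_gt0.
by rewrite mulfK // /K Wy divfK // -Wy.
Qed.

(** The index gaps in a Lagrange denominator: nodes to the left contribute the first factorial,
    nodes to the right the second. *)
Lemma prod_distn n (i : 'I_n.+1) :
  (\prod_(j < n.+1 | j != i) `|i - j|%N = i`! * (n - i)`!)%N.
Proof.
have hi := ltn_ord i.
rewrite -(big_mkord (fun j => j != i) (fun j => `|i - j|%N)).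
rewrite (@big_cat_nat _ _ _ i) //=; last exact: ltnW.
rewrite [X in (_ * X)%N](@big_ltn_cond _ _ _ i) // eqxx /=; congr (_ * _)%N.
  rewrite big_nat_cond (eq_bigl (fun j => (0 <= j < i) && true)%N); last first.
    by move=> j; rewrite leq0n andbT /=; case: (ltnP j i) => //= ji; rewrite neq_ltn ji.
  rewrite -big_nat_cond big_nat_rev fact_prod big_add1 /=.
  by apply: eq_big_nat => j /andP[_ ji]; rewrite distnEl ?leq_subr // subKn // add0n.
rewrite big_nat_cond (eq_bigl (fun j => (i.+1 <= j < n.+1) && true)%N); last first.
  by move=> j; rewrite andbT; case: (ltnP i j) => //= ji; rewrite neq_ltn ji orbT andbT.
rewrite -big_nat_cond -{1}(add0n i.+1) big_addn subSS fact_prod big_add1 /=.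
by apply: eq_big_nat => j _; rewrite distnEr ?addnS ?leqW ?leq_addl // subSn ?leq_addl // addnK.
Qed.

(** Numerators have factors at most [L], denominators have factors at least [|i - j| d], so the
    [i]-th basis polynomial is at most [(L / d)^n / (i! (n - i)!)]. Summing over [i] by the binomial
    theorem gives [2^n / n!]. *)
Lemma lagrange_interpolation n (x v : nat -> R) (d L M p : R) : 0 < d -> 0 <= M ->
  (forall i, (i < n.+1)%N -> p <= x i <= p + L) ->
  (forall i j, (i < j < n.+1)%N -> (j - i)%:R * d <= x j - x i) ->
  (forall i, (i < n.+1)%N -> `|v i| <= M) ->
  exists P : {poly R}, [/\ (size P <= n.+1)%N, forall i, (i < n.+1)%N -> P.[x i] = v i &
    forall y, p <= y <= p + L -> `|P.[y]| <= (L / d) ^+ n * 2 ^+ n / n`!%:R * M].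
Proof.
move=> d0 M0 xp xd vM.
have dist (i j : 'I_n.+1) : j != i -> (`|i - j|%N)%:R * d <= `|x i - x j|.
  move=> ji; case: (ltngtP i j) => ij; last by move: ji; rewrite (val_inj ij) eqxx.
    by rewrite distnEr ?(ltnW ij) // distrC (le_trans (xd i j _)) ?ler_norm // ij /=.
  by rewrite distnEl ?(ltnW ij) // (le_trans (xd j i _)) ?ler_norm // ij /=.
have dn0 (i j : 'I_n.+1) : j != i -> x i - x j != 0.
  move=> ji; rewrite -normr_gt0 (lt_le_trans _ (dist i j ji)) // mulr_gt0 //.
  by rewrite ltr0n lt0n distn_eq0 eq_sym.
pose l (i : 'I_n.+1) : {poly R} :=
  (\prod_(j < n.+1 | j != i) (x i - x j))^-1 *: \prod_(j < n.+1 | j != i) ('X - (x j)%:P).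
have lE (i : 'I_n.+1) y : (l i).[y] = \prod_(j < n.+1 | j != i) ((y - x j) / (x i - x j)).
  rewrite /l hornerZ horner_prod mulrC -prodfV -big_split /=.
  by apply: eq_bigr => j _; rewrite hornerXsubC.
exists (\sum_(i < n.+1) v i *: l i); split.
- apply: leq_trans (size_sum _ _ _) _; apply/bigmax_leqP => i _.
  apply: leq_trans (size_scale_leq _ _) _; apply: leq_trans (size_scale_leq _ _) _.
  by rewrite -big_filter size_prod_XsubC size_filter -sum1_count sum1_card cardC1 card_ord.
- move=> i lin; rewrite horner_sum (bigD1 (Ordinal lin)) //= hornerZ lE big1 ?mulr1; last first.
    by move=> j ji; rewrite divff // (dn0 (Ordinal lin)).
  rewrite big1 ?addr0 // => j ji; rewrite hornerZ lE (bigD1 (Ordinal lin)) 1?eq_sym //=.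
  by rewrite subrr mul0r mul0r mulr0.
- move=> y /andP[py yq]; rewrite horner_sum.
  apply: le_trans (ler_norm_sum _ _ _) _.
  have bnd (i : 'I_n.+1) : `|(v i *: l i).[y]| <= (L / d) ^+ n / (i`! * (n - i)`!)%N%:R * M.
    rewrite hornerZ normrM mulrC; apply: ler_pM => //; last exact: vM.
    rewrite lE normr_prod -prod_distn natr_prod.
    have -> : (L / d) ^+ n = \prod_(j < n.+1 | j != i) (L / d).
      by rewrite prodr_const cardC1 card_ord.
    rewrite -prodfV -big_split /=; apply: ler_prod => j ji; rewrite normr_ge0 /= normrM normfV.
    have L0 : 0 <= L by lra.
    have k0 : 0 < (`|i - j|%N)%:R :> R by rewrite ltr0n lt0n distn_eq0 eq_sym.
    rewrite -mulrA -invfM; apply: ler_pM => //.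
      by have /andP[h1 h2] := xp j (ltn_ord j); rewrite ler_norml; apply/andP; split; lra.
    by rewrite lef_pV2 ?posrE ?normr_gt0 ?dn0 ?mulr_gt0 // mulrC dist.
  apply: le_trans (ler_sum _ (fun i _ => bnd i)) _.
  rewrite -mulr_suml ler_wpM2r // -mulr_sumr -mulrA (_ : \sum_(i < n.+1) _ = 2 ^+ n / n`!%:R) //.
  have -> : (2 : R) ^+ n = \sum_(i < n.+1) 'C(n, i)%:R.
    by rewrite -natr_sum -natrX -[2%N]/(1 + 1)%N expnDn; congr _%:R; apply: eq_bigr => i _; rewrite !exp1n !muln1.
  rewrite mulr_suml; apply: eq_bigr => i _.
  have hin : (i <= n)%N by rewrite -ltnS.
  rewrite -(bin_fact hin) [in RHS]natrM [in RHS]invfM [RHS]mulrA divff ?mul1r //.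
  by rewrite pnatr_eq0 -lt0n bin_gt0.
Qed.

End Interpolation.

(** * From a large subset of an interval to the whole interval *)

Section LocalEstimate.
Context {R : realType}.
Local Notation mu := (@lebesgue_measure R).
Implicit Types (A G : set R) (phi psi : R -> R) (p q L : R).

Lemma mu_itv_cc (p q : R) : p <= q -> mu `[p, q]%classic = (q - p)%:E.
Proof.
move=> pq; rewrite lebesgue_measure_itv /= lte_fin; case: ltP => // qp.
by rewrite (_ : q = p) ?subrr //; apply/eqP; rewrite eq_le qp.
Qed.

Lemma Rintegral_cst_itv (c p L : R) : 0 <= L ->
  \int[mu]_(x in `[p, (p + L)%R]) c = c * L.
Proof.
move=> L0; rewrite Rintegral_cst; last exact: measurable_itv.
congr (_ * _); have pL : p <= p + L by rewrite lerDl.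
by rewrite -[RHS](addKr p) [RHS]addrC; exact: (congr1 fine (mu_itv_cc pL)).
Qed.

Lemma mu_bounded_fin A p q : measurable A -> A `<=` `[p, q]%classic -> mu A \is a fin_num.
Proof.
move=> mA Apq; rewrite ge0_fin_numE //.
have : (mu A <= mu `[p, q]%classic)%E by apply: le_measure; rewrite ?inE.
move=> /le_lt_trans; apply; rewrite lebesgue_measure_itv /=; case: ifP => _; by rewrite ?ltry // -EFinB ltry.
Qed.

(** Greedy choice from the left: take a point close to the infimum, discard everything up to
    distance [d] to its right, and repeat in what remains. *)
Lemma spaced_points n G (d p q : R) : measurable G -> G `<=` `[p, q]%classic -> 0 < d ->
  ((n%:R * d)%:E < mu G)%E ->
  exists x : nat -> R, (forall i, (i < n.+1)%N -> G (x i)) /\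
    (forall i j, (i < j < n.+1)%N -> (j - i)%:R * d <= x j - x i).
Proof.
move=> + + d0; elim: n G => [|n IH] G mG Gpq muG.
  have [x Gx] : exists x, G x.
    apply/set0P/eqP => G0; by rewrite G0 measure0 mul0r ltxx in muG.
  exists (fun=> x); split=> // i j /andP[ij]; rewrite ltnS leqn0 => /eqP j0.
  by rewrite j0 in ij.
have fG := mu_bounded_fin mG Gpq.
have hG : has_inf G.
  split; last by exists p => x /Gpq /=; rewrite in_itv /= => /andP[].
  apply/set0P/eqP => G0; move: muG; rewrite G0 measure0 lte_fin ltNge => /negP; apply.
  by rewrite mulr_ge0 // ltW.
move: muG; rewrite -(fineK fG) lte_fin => muG.
(* Half of the excess measure: the discarded piece is shorter than [d + e], so more than [n d]
   remains. *)
pose e := (fine (mu G) - n.+1%:R * d) / 2.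
have e0 : 0 < e by rewrite /e divr_gt0 // subr_gt0.
have [x0 Gx0 x0e] := inf_adherent e0 hG.
have lb y : G y -> inf G <= y by move=> Gy; apply: ge_inf => //; case: hG.
pose G' := G `&` `[x0 + d, +oo[%classic.
have mG' : measurable G' by apply: measurableI => //; exact: measurable_itv.
have G'pq : G' `<=` `[p, q]%classic by move=> y [/Gpq].
have fG' := mu_bounded_fin mG' G'pq.
have le1 : (mu G <= mu `[inf G, (x0 + d)%R]%classic + mu G')%E.
  apply: (@le_trans _ _ (mu (`[inf G, (x0 + d)%R]%classic `|` G'))); last first.
    by apply: measureU2 => //; exact: measurable_itv.
  apply: le_measure; rewrite ?inE //; first by apply: measurableU => //; exact: measurable_itv.
  move=> y Gy; case: (leP y (x0 + d)) => h; [left|right] => /=.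
    by rewrite in_itv /= lb.
  by split => //=; rewrite in_itv /= andbT ltW.
have [|x [Gx xd]] := IH G' mG' G'pq.
  rewrite mu_itv_cc in le1; last by rewrite (le_trans (lb _ Gx0)) // lerDl ltW.
  move: le1; rewrite -(fineK fG) -(fineK fG') -EFinD lee_fin lte_fin.
  by move: muG x0e; rewrite /e -natr1 mulrDl mul1r; lra.
exists (fun i => if i is k.+1 then x k else x0); split.
  by case=> [|i] // hi; case: (Gx i hi).
case=> [|i] [|j] //=; last by rewrite ltnS subSS => h; exact: xd.
rewrite ltnS subn0 => hj; have x1 : x0 + d <= x 0%N.
  by have [_ /=] := Gx 0%N isT; rewrite in_itv /= andbT.
case: j hj => [|j] hj; first by rewrite mul1r; lra.
have := xd 0%N j.+1 hj; rewrite subn0 -[in X in _ -> X]natr1 mulrDl mul1r; lra.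
Qed.

Lemma continuous_itv_integrable (f : R -> R) p q : continuous f ->
  mu.-integrable `[p, q]%classic (EFin \o f).
Proof.
move=> cf; apply: continuous_compact_integrable; first exact: segment_compact.
exact: continuous_subspaceT.
Qed.

Lemma integral_itv_subset (f : R -> R) (p q p' q' : R) : continuous f -> (forall x, 0 <= f x) ->
  p' <= p -> q <= q' -> \int[mu]_(x in `[p, q]) f x <= \int[mu]_(x in `[p', q']) f x.
Proof.
move=> cf f0 pp qq; apply: fine_le.
- exact: integrable_fin_num (continuous_itv_integrable _ _ cf).
- exact: integrable_fin_num (continuous_itv_integrable _ _ cf).
apply: ge0_subset_integral => //.
- by apply/measurable_EFinP; apply: measurable_funTS; exact: continuous_measurable_fun.
- by move=> x _; rewrite lee_fin.
- by move=> x /=; rewrite !in_itv /= => /andP[h1 h2]; rewrite (le_trans pp) //= (le_trans h2).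
Qed.

(** The derivative of [psi^2] is [2 psi psi'], bounded in modulus by [psi^2 + psi'^2]. *)
Lemma sqr_increment psi dpsi (p q y x : R) : (forall z : R, is_derive z 1 psi (dpsi z)) -> continuous dpsi ->
  p <= y -> y < x -> x <= q ->
  `|psi x ^+ 2 - psi y ^+ 2| <= \int[mu]_(z in `[p, q]) (psi z ^+ 2 + dpsi z ^+ 2).
Proof.
move=> dP cd py yx xq; have cp := is_derive_continuous dP.
have cX (f : R -> R) : continuous f -> continuous (fun z => f z ^+ 2).
  by move=> cf z; apply: (cvg_comp f (fun u : R => u ^+ 2)); [exact: cf|exact: exprn_continuous].
have c1 : continuous (fun z => 2 * (psi z * dpsi z)).
  by move=> z; apply: cvgM; [exact: cvg_cst|apply: cvgM; [exact: cp|exact: cd]].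
have c2 : continuous (fun z => psi z ^+ 2 + dpsi z ^+ 2).
  by move=> z; apply: cvgD; [exact: cX|exact: cX].
have c3 : continuous (fun z => `|2 * (psi z * dpsi z)|).
  by move=> z; apply: (cvg_comp (fun z => 2 * (psi z * dpsi z)) (fun u : R => `|u|)); [exact: c1|exact: norm_continuous].
have dS z : is_derive (z : R) 1 (fun z => psi z ^+ 2) (2 * (psi z * dpsi z)).
  have -> : (fun z => psi z ^+ 2) = (fun z => psi z * psi z) by apply/funext => u; rewrite expr2.
  by apply: is_derive_eq; rewrite /GRing.scale /=; ring.
have -> : psi x ^+ 2 - psi y ^+ 2 = \int[mu]_(z in `[y, x]) (2 * (psi z * dpsi z)).
  rewrite /Rintegral (@continuous_FTC2 _ _ (fun z => psi z ^+ 2)) //.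
  - exact: continuous_subspaceT.
  - split; first by move=> z _; have [] := dS z.
      by apply: cvg_at_right_filter; exact: cX.
    by apply: cvg_at_left_filter; exact: cX.
  - by move=> z _; rewrite derive1E; have [] := dS z.
apply: le_trans (le_normr_Rintegral _ (continuous_itv_integrable _ _ c1)) _; first exact: measurable_itv.
apply: (@le_trans _ _ (\int[mu]_(z in `[y, x]) (psi z ^+ 2 + dpsi z ^+ 2))).
  apply: le_Rintegral; [exact: measurable_itv|exact: continuous_itv_integrable|exact: continuous_itv_integrable|].
  move=> z _; rewrite ler_norml; have := sqr_ge0 (psi z + dpsi z); have := sqr_ge0 (psi z - dpsi z).
  by move: (psi z) (dpsi z) => u v; rewrite !expr2 => *; apply/andP; split; lra.
by apply: integral_itv_subset => // z; rewrite addr_ge0 ?sqr_ge0.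
Qed.

(** A one-dimensional Sobolev bound. The minimum of [psi^2] on the interval is at most its mean,
    hence at most its integral as [L >= 1]; the increment from a minimum point is
    [sqr_increment]. *)
Lemma sup_sqr_bound psi dpsi (p L x : R) : (forall z : R, is_derive z 1 psi (dpsi z)) -> continuous dpsi ->
  1 <= L -> p <= x <= p + L ->
  psi x ^+ 2 <= \int[mu]_(z in `[p, (p + L)%R]) (2 * psi z ^+ 2 + dpsi z ^+ 2).
Proof.
move=> dP cd L1 /andP[px xq]; have cp := is_derive_continuous dP.
have cX (f : R -> R) : continuous f -> continuous (fun z => f z ^+ 2).
  by move=> cf z; apply: (cvg_comp f (fun u : R => u ^+ 2)); [exact: cf|exact: exprn_continuous].
have cpX := cX _ cp.
have c2 : continuous (fun z => psi z ^+ 2 + dpsi z ^+ 2).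
  by move=> z; apply: cvgD; [exact: cX|exact: cX].
have pL : p <= p + L by lra.
have [y yin ymin] := EVT_min pL (continuous_subspaceT cpX).
have hy : psi y ^+ 2 <= \int[mu]_(z in `[p, (p + L)%R]) (psi z ^+ 2).
  apply: (@le_trans _ _ (\int[mu]_(z in `[p, (p + L)%R]) (psi y ^+ 2))).
    by rewrite Rintegral_cst_itv ?ler_peMr ?sqr_ge0 //; lra.
  apply: le_Rintegral; [exact: measurable_itv| |exact: continuous_itv_integrable|].
    by apply: (@continuous_itv_integrable (cst (psi y ^+ 2))); exact: cst_continuous.
  by move=> z zin; exact: ymin.
have hx : psi x ^+ 2 - psi y ^+ 2 <= \int[mu]_(z in `[p, (p + L)%R]) (psi z ^+ 2 + dpsi z ^+ 2).
  move: yin; rewrite in_itv /= => /andP[py yq].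
  case: (ltgtP x y) => [xy|yx|->].
  - by apply: le_trans (ler_norm _) _; rewrite distrC; exact: sqr_increment.
  - by apply: le_trans (ler_norm _) _; exact: sqr_increment.
  - by rewrite subrr; apply: Rintegral_ge0 => z _; rewrite addr_ge0 ?sqr_ge0.
have -> : \int[mu]_(z in `[p, (p + L)%R]) (2 * psi z ^+ 2 + dpsi z ^+ 2) =
   \int[mu]_(z in `[p, (p + L)%R]) (psi z ^+ 2) + \int[mu]_(z in `[p, (p + L)%R]) (psi z ^+ 2 + dpsi z ^+ 2).
  rewrite -RintegralD; [|exact: measurable_itv|exact: continuous_itv_integrable|exact: continuous_itv_integrable].
  by apply: eq_Rintegral => z _; ring.
lra.
Qed.

(* Norm of Lagrange interpolation at [n.+1] nodes of an interval of length [L]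
   with gaps at least [g * L / (4 * n.+1)]. *)
Definition Lam (n : nat) (g : R) : R := (4 * n.+1%:R / g) ^+ n * 2 ^+ n / n`!%:R.

Lemma local_estimate (D : nat -> R -> R) A n (g p L : R) :
  (forall k (z : R), is_derive z 1 (D k) (D k.+1 z)) -> measurable A ->
  0 < g -> 1 <= L -> ((g * L)%:E <= mu (A `&` `[p, (p + L)%R]%classic))%E ->
  \int[mu]_(x in `[p, (p + L)%R]) (D 0%N x ^+ 2) <=
  4 * Lam n g ^+ 2 / g * \int[mu]_(x in A `&` `[p, (p + L)%R]) (D 0%N x ^+ 2) +
  2 * L * (L ^+ n.+1 / n.+1`!%:R) ^+ 2 *
    \int[mu]_(z in `[p, (p + L)%R]) (2 * D n.+1 z ^+ 2 + D n.+2 z ^+ 2).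
Proof.
move=> dD mA g0 L1 muA.
have cD k : continuous (D k) by exact: is_derive_continuous (dD k).
have cX k : continuous (fun z => D k z ^+ 2).
  by move=> z; apply: (cvg_comp (D k) (fun u : R => u ^+ 2)); [exact: cD|exact: exprn_continuous].
have mX k : measurable_fun setT (fun z => D k z ^+ 2) by exact: continuous_measurable_fun.
set I : set R := `[p, (p + L)%R]%classic in muA *.
have mI : measurable I by exact: measurable_itv.
have mAI : measurable (A `&` I) by exact: measurableI.
have iI : mu.-integrable I (EFin \o (fun z => D 0%N z ^+ 2)) by exact: continuous_itv_integrable.
have iAI : mu.-integrable (A `&` I) (EFin \o (fun z => D 0%N z ^+ 2)).
  by apply: integrableS iI => // z [].
set B := \int[mu]_(x in A `&` I) (D 0%N x ^+ 2).
have B0 : 0 <= B by apply: Rintegral_ge0 => x _; exact: sqr_ge0.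
set T := \int[mu]_(z in I) (2 * D n.+1 z ^+ 2 + D n.+2 z ^+ 2).
have T0 : 0 <= T by apply: Rintegral_ge0 => x _; apply: addr_ge0; [apply: mulr_ge0 => //|]; exact: sqr_ge0.
have L0 : 0 < L by lra.
have gL0 : 0 < g * L by rewrite mulr_gt0.
set m := fine (mu (A `&` I)).
have fm : mu (A `&` I) = m%:E by rewrite /m fineK // (@mu_bounded_fin _ p (p + L)) // => z [].
have gLm : g * L <= m by move: muA; rewrite fm lee_fin.
have m0 : 0 < m by exact: lt_le_trans gLm.
(* [c] stays strictly above twice the mean of the square over [A] in the interval: this keeps [c]
   positive even if [B = 0], and makes Markov's inequality strict. *)
have main c : 2 * B / m < c ->
  \int[mu]_(x in I) (D 0%N x ^+ 2) <= 2 * L * Lam n g ^+ 2 * c + 2 * L * (L ^+ n.+1 / n.+1`!%:R) ^+ 2 * T.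
  move=> Bc; have c0 : 0 < c by apply: le_lt_trans Bc; rewrite divr_ge0 ?mulr_ge0 // ltW.
  pose H : set R := (A `&` I) `&` [set x | c <= D 0%N x ^+ 2].
  pose G : set R := (A `&` I) `&` [set x | D 0%N x ^+ 2 < c].
  have mH : measurable H.
    have := @measurable_fun_ler _ R R (A `&` I) (fun=> c) (fun x => D 0%N x ^+ 2) _ _.
    move=> /(_ _ _ mAI [set true]) h; rewrite /H; apply: h => //.
    exact: measurable_funTS.
  have mG : measurable G.
    have := @measurable_fun_ltr _ R R (A `&` I) (fun x => D 0%N x ^+ 2) (fun=> c) _ _.
    move=> /(_ _ _ mAI [set true]) h; rewrite /G; apply: h => //.
    exact: measurable_funTS.
  have GI : G `<=` `[p, (p + L)%R]%classic by move=> z [[]].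
  have HI : H `<=` `[p, (p + L)%R]%classic by move=> z [[]].
  have fG := mu_bounded_fin mG GI; have fH := mu_bounded_fin mH HI.
  have mHG : m <= fine (mu H) + fine (mu G).
    rewrite -lee_fin EFinD (fineK fH) (fineK fG) -fm.
    apply: (@le_trans _ _ (mu (H `|` G))); last exact: measureU2.
    apply: le_measure; rewrite ?inE //; first exact: measurableU.
    by move=> z zAI; case: (leP c (D 0%N z ^+ 2)) => h; [left|right].
  have markov : c * fine (mu H) <= B.
    rewrite -Rintegral_cst //.
    apply: (@le_trans _ _ (\int[mu]_(x in H) (D 0%N x ^+ 2))).
      apply: le_Rintegral => //.
      + by apply: integrableS (@continuous_itv_integrable (cst c) p (p + L) (@cst_continuous _ _ c)).
      + by apply: integrableS iI.
      + by move=> x [].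
    apply: fine_le; [by apply: integrable_fin_num => //; apply: integrableS iI|exact: integrable_fin_num|].
    apply: ge0_subset_integral => //.
    - exact: measurable_int iAI.
    - by move=> x _; rewrite lee_fin sqr_ge0.
    - by move=> x [].
  have Gbig : m / 2 < fine (mu G).
    have h1 : 2 * B < c * m by rewrite -ltr_pdivrMr.
    have h2 : 2 * (c * fine (mu H)) < c * m by apply: le_lt_trans h1; rewrite ler_pM2l.
    have h3 : 2 * fine (mu H) < m by rewrite -(ltr_pM2l c0); lra.
    lra.
  (* [n] gaps of length [d] use less than [g L / 4], which is below [m / 2] and hence below the
     measure of [G]. *)
  pose d := g * L / (4 * n.+1%:R).
  have n0 : 0 < n.+1%:R :> R by [].
  have d0 : 0 < d by rewrite /d divr_gt0 // mulr_gt0.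
  have nd : ((n%:R * d)%:E < mu G)%E.
    rewrite -(fineK fG) lte_fin; apply: lt_trans Gbig; rewrite /d.
    apply: (@lt_le_trans _ _ (g * L / 2)); last by rewrite ler_pM2r.
    rewrite mulrCA ltr_pM2l // invfM mulrCA; rewrite [ltLHS](_ : _ = 4^-1 * (n%:R / n.+1%:R)); last by ring.
    apply: (@lt_le_trans _ _ (4^-1 * 1)); last by lra.
    by rewrite ltr_pM2l // ltr_pdivrMr // mul1r ltr_nat.
  have [x [Gx xd]] := spaced_points mG GI d0 nd.
  have xI i : (i < n.+1)%N -> p <= x i <= p + L by move=> /Gx /GI; rewrite /= in_itv.
  pose M := Num.sqrt c.
  have M0 : 0 <= M by exact: sqrtr_ge0.
  have M2 : M ^+ 2 = c by rewrite sqr_sqrtr // ltW.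
  have vM i : (i < n.+1)%N -> `|D 0%N (x i)| <= M.
    move=> /Gx[_ /= h]; rewrite -(@ler_pXn2r _ 2) ?nnegrE // real_normK ?num_real // M2 ltW //.
  have [P [sP Px PM]] := @lagrange_interpolation R n x (fun i => D 0%N (x i)) d L M p d0 M0 xI xd vM.
  have xinc i j : (i < j < n.+1)%N -> x i < x j.
    move=> ij; rewrite -subr_gt0; apply: lt_le_trans (xd _ _ ij); rewrite mulr_gt0 // ltr0n subn_gt0.
    by case/andP: ij.
  have LamE : (L / d) ^+ n * 2 ^+ n / n`!%:R = Lam n g.
    rewrite /Lam /d; congr (_ ^+ n * _ / _); field.
    by rewrite !gt_eqF //.
  (* With [n + 1] nodes the error involves the derivative of order [n + 1] at an unknown point;
     [sup_sqr_bound] replaces its square by [T], at the price of the derivative of order [n + 2]. *)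
  have pw z : p <= z <= p + L -> D 0%N z ^+ 2 <= 2 * (Lam n g ^+ 2 * c) + 2 * ((L ^+ n.+1 / n.+1`!%:R) ^+ 2 * T).
    move=> zI; have [xi xiI e] := @interpolation_error R D n.+1 x P p (p + L) z dD xI xinc zI sP Px.
    have b1 := PM z zI; rewrite LamE in b1.
    have b2 : (D 0%N z - P.[z]) ^+ 2 <= (L ^+ n.+1 / n.+1`!%:R) ^+ 2 * T.
      rewrite e -mulrA exprMn [leRHS]mulrC; apply: ler_pM; rewrite ?sqr_ge0 //.
        exact: sup_sqr_bound (dD n.+1) (cD n.+2) L1 xiI.
      rewrite -[leLHS]real_normK ?num_real // lerXn2r ?nnegrE //.
        by rewrite divr_ge0 // exprn_ge0 // ltW.
      rewrite mulrC normrM normfV normr_nat ler_pM2r ?invr_gt0 ?ltr0n ?fact_gt0 // normr_prod.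
      have -> : L ^+ n.+1 = \prod_(i < n.+1) L by rewrite prodr_const card_ord.
      apply: ler_prod => i _; rewrite normr_ge0 /=; have /andP[h1 h2] := xI i (ltn_ord i).
      by case/andP: zI => h3 h4; rewrite ler_norml; apply/andP; split; lra.
    have b3 : P.[z] ^+ 2 <= Lam n g ^+ 2 * c.
      rewrite -M2 -exprMn -[leLHS]real_normK ?num_real // lerXn2r ?nnegrE //.
      by apply: le_trans b1.
    have := sqr_ge0 (P.[z] - (D 0%N z - P.[z])); move: b2 b3.
    move: (D 0%N z) (P.[z]) => u v; rewrite !expr2 => *; lra.
  pose K : R := 2 * (Lam n g ^+ 2 * c) + 2 * ((L ^+ n.+1 / n.+1`!%:R) ^+ 2 * T).
  have iK : mu.-integrable I (EFin \o cst K).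
    by apply: continuous_itv_integrable; exact: cst_continuous.
  apply: (@le_trans _ _ (\int[mu]_(x in I) K)).
    by apply: le_Rintegral => // z; rewrite /I /= in_itv; exact: pw.
  rewrite Rintegral_cst_itv /K; last exact: ltW.
  by move: (Lam n g ^+ 2) ((L ^+ n.+1 / n.+1`!%:R) ^+ 2) => u v; lra.
have Lam0 : 0 <= Lam n g ^+ 2 by exact: sqr_ge0.
(* Let [c] decrease to [2 B / m]; the [+ 1] below makes the denominator visibly positive. *)
have e1 : \int[mu]_(x in I) (D 0%N x ^+ 2) <= 2 * L * Lam n g ^+ 2 * (2 * B / m) + 2 * L * (L ^+ n.+1 / n.+1`!%:R) ^+ 2 * T.
  apply/ler_addgt0Pr => e e0.
  have k0 : 0 < 2 * L * Lam n g ^+ 2 + 1 by rewrite ltr_wpDl // mulr_ge0 // mulr_ge0 // ltW.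
  have h := main (2 * B / m + e / (2 * L * Lam n g ^+ 2 + 1)) _.
  apply: le_trans (h _) _; first by rewrite ltrDl divr_gt0.
  rewrite mulrDr addrAC lerD2l mulrA ler_pdivrMr // mulrC ler_pM2l //; lra.
apply: le_trans e1 _; rewrite lerD2r.
apply: (@le_trans _ _ (2 * L * Lam n g ^+ 2 * (2 * B / (g * L)))).
  apply: ler_wpM2l; first by apply: mulr_ge0 => //; apply: mulr_ge0 => //; exact: ltW.
  by apply: ler_wpM2l; [exact: mulr_ge0|rewrite lef_pV2 ?posrE].
rewrite le_eqVlt; apply/orP; left; apply/eqP; field.
by rewrite !gt_eqF.
Qed.

End LocalEstimate.

(** * The Logvinenko-Sereda inequality *)

Section Constants.
Context {R : realType}.
Implicit Types (g L : R) (n N : nat).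

Lemma expR1_le4 : expR 1 <= 4 :> R.
Proof.
have h : (2^-1 : R) <= expR (- 2^-1).
  by have := expR_ge1Dx (- 2^-1 : R); lra.
rewrite [X in expR X](_ : 1 = 2^-1 + 2^-1); last by lra.
rewrite expRD; have p := expR_gt0 (2^-1 : R).
have e2 : expR (2^-1 : R) <= 2.
  by move: h; rewrite expRN lef_pV2 ?posrE.
rewrite [leRHS](_ : _ = 2 * 2); last by lra.
by apply: ler_pM => //; exact: ltW.
Qed.

(** The quotient is one term of the exponential series at [N], hence at most [e^N]. *)
Lemma pow_le_fact N : N%:R ^+ N / N`!%:R <= 4 ^+ N :> R.
Proof.
case: N => [|n]; first by rewrite !expr0 divr1.
apply: (@le_trans _ _ (expR n.+1%:R)).
  by have := @expR_ge1Dxn R n.+1%:R n (ler0n _ _); lra.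
have -> : n.+1%:R = n.+1%:R * 1 :> R by rewrite mulr1.
rewrite expRM_natl lerXn2r ?nnegrE ?expR_ge0 //; exact: expR1_le4.
Qed.

Lemma Lam_ge0 n g : 0 < g -> 0 <= Lam n g.
Proof.
move=> g0; rewrite /Lam; apply: divr_ge0 => //; apply: mulr_ge0; last exact: exprn_ge0.
by apply: exprn_ge0; apply: divr_ge0; [rewrite mulr_ge0|exact: ltW].
Qed.

(** Writing [(n+1)^n / n!] as [(n+1)^(n+1) / (n+1)!] brings [Lam] to the form of [pow_le_fact]. The
    loose factor [8 / g], which is at least [1], is absorbed by raising the power from [n] to
    [n + 1]. *)
Lemma Lam_bound n g : 0 < g -> g <= 1 -> 8 * Lam n g ^+ 2 / g <= (32 / g) ^+ n.+1 ^+ 2.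
Proof.
move=> g0 g1.
have LE : Lam n g = (8 / g) ^+ n * (n.+1%:R ^+ n.+1 / n.+1`!%:R).
  rewrite /Lam factS natrM invfM exprS mulrACA divff ?mul1r; last by rewrite pnatr_eq0.
  rewrite mulrA; congr (_ / _).
  rewrite -!exprMn; congr (_ ^+ n); field; by rewrite gt_eqF.
have k1 : 1 <= 8 / g by rewrite ler_pdivlMr //; lra.
have k0 : 0 <= 8 / g by lra.
have Lb : Lam n g <= (8 / g) ^+ n * 4 ^+ n.+1.
  by rewrite LE ler_wpM2l ?exprn_ge0 //; exact: pow_le_fact.
have -> : (32 / g) ^+ n.+1 ^+ 2 = (8 / g) ^+ n.+1 ^+ 2 * 4 ^+ n.+1 ^+ 2.
  by rewrite -!exprMn; congr (_ ^+ _ ^+ _); field; rewrite gt_eqF.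
rewrite mulrAC; apply: (@le_trans _ _ (8 / g * ((8 / g) ^+ n * 4 ^+ n.+1) ^+ 2)).
  by rewrite ler_wpM2l // lerXn2r ?nnegrE ?Lam_ge0 // mulr_ge0 ?exprn_ge0.
rewrite exprMn mulrA ler_wpM2r ?sqr_ge0 //.
move: (8 / g) k0 k1 => k k0 k1.
by rewrite [k ^+ n.+1]exprS (exprMn _ k) ler_wpM2r ?sqr_ge0 // expr2 ler_peMl.
Qed.

(** From [8 L <= N / 8] and [N^N / N! <= 4^N] the quotient is at most [2^-N]; its square [4^-N]
    beats [132 L <= 3 N] once [N >= 2]. Here [132 = 2 * 66], and [66 = 2 + 64] collects the
    derivatives of orders [N] and [N + 1]. *)
Lemma err_bound N L : 0 < L -> (2 <= N)%N -> 64 * L <= N%:R ->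
  132 * L * ((8 * L) ^+ N / N`!%:R) ^+ 2 <= 2^-1.
Proof.
move=> L0 N2 NL.
have f0 : 0 < (N`!%:R : R) by rewrite ltr0n fact_gt0.
have h1 : (8 * L) ^+ N / N`!%:R <= (2^-1) ^+ N.
  apply: (@le_trans _ _ ((8^-1) ^+ N * (N%:R ^+ N / N`!%:R))).
    rewrite mulrA -exprMn ler_pM2r ?invr_gt0 // lerXn2r ?nnegrE ?mulr_ge0 //; lra.
  apply: (@le_trans _ _ ((8^-1) ^+ N * 4 ^+ N)).
    by rewrite ler_wpM2l ?exprn_ge0 //; exact: pow_le_fact.
  by rewrite -exprMn le_eqVlt; apply/orP; left; apply/eqP; congr (_ ^+ _); field.
have h2 : ((8 * L) ^+ N / N`!%:R) ^+ 2 <= (4^-1) ^+ N.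
  have -> : (4^-1 : R) ^+ N = ((2^-1) ^+ N) ^+ 2 by rewrite -!exprM mulnC exprM; congr (_ ^+ _); field.
  rewrite lerXn2r ?nnegrE ?exprn_ge0 ?divr_ge0 ?exprn_ge0 ?mulr_ge0 //; exact: ltW.
apply: (@le_trans _ _ (3 * N%:R * (4^-1) ^+ N)).
  apply: ler_pM => //; rewrite ?sqr_ge0 //; first by rewrite mulr_ge0 // ltW.
  lra.
have h3 : forall m, (2 <= m)%N -> 6 * m%:R <= 4 ^+ m :> R.
  elim=> [//|m IH]; rewrite leq_eqVlt => /orP[/eqP <-|]; first by rewrite expr2; lra.
  rewrite ltnS => m2; have := IH m2; rewrite exprS -natr1.
  have : (2 : R) <= m%:R by rewrite (ler_nat _ 2%N).
  lra.
rewrite exprVn ler_pdivrMr ?exprn_gt0 //.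
have := h3 N N2; lra.
Qed.

(** [129] serves twice: [g / 129 <= 1] lets the exponent drop from [129 a] to [N], and [129 >= 32]
    lets the base rise to [g / 32], the inverse of [32 / g]. *)
Lemma final_constant (g a : R) N : 0 < g -> g <= 1 -> 0 < a -> N%:R <= 129 * a ->
  (g / 129) `^ (129 * a) * (32 / g) ^+ N <= 1.
Proof.
move=> g0 g1 a0 Na.
have k0 : 0 < g / 129 by rewrite divr_gt0.
apply: (@le_trans _ _ ((g / 32) ^+ N * (32 / g) ^+ N)); last first.
  rewrite -exprMn (_ : g / 32 * (32 / g) = 1) ?expr1n //; field; by rewrite gt_eqF.
rewrite ler_wpM2r ?exprn_ge0 ?divr_ge0 //; first exact: ltW.
apply: (@le_trans _ _ ((g / 129) ^+ N)).
  rewrite -powR_mulrn ?(ltW k0) //; apply: ger_powR => //; apply/andP; split => //; lra.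
by rewrite lerXn2r ?nnegrE ?divr_ge0 ?(ltW g0) // ler_wpM2l ?(ltW g0) // lef_pV2 ?posrE //; lra.
Qed.

End Constants.

(** * Summation over intervals *)

Section SumIntervals.
Context {R : realType}.
Local Notation mu := (@lebesgue_measure R).

Lemma Rintegral_itv_split (f : R -> R) (p r q : R) : itg f -> p <= r -> r <= q ->
  \int[mu]_(x in `[p, q]) f x = \int[mu]_(x in `[p, r]) f x + \int[mu]_(x in `[r, q]) f x.
Proof.
move=> i pr rq.
have iS (I : interval R) : mu.-integrable [set` I] (EFin \o f).
  by apply: integrableS i.
have := @Rintegral_itvB R f (BLeft p) (BRight q) r (iS _).
rewrite !bnd_simp => /(_ pr rq); rewrite Rintegral_itv_obnd_cbnd //.
by move=> <-; rewrite addrC subrK.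
Qed.

(** Adjacent intervals tile [[- n L, n L]], and dominated convergence passes to the line. *)
Lemma sum_intervals (F G : R -> R) (L : R) : itg F -> itg G -> 0 < L ->
  (forall p, \int[mu]_(x in `[p, (p + L)%R]) F x <= \int[mu]_(x in `[p, (p + L)%R]) G x) ->
  \int[mu]_x F x <= \int[mu]_x G x.
Proof.
move=> iF iG L0 FG.
have step k p : \int[mu]_(x in `[p, (p + k%:R * L)%R]) F x <= \int[mu]_(x in `[p, (p + k%:R * L)%R]) G x.
  elim: k => [|k IH]; first by rewrite mul0r addr0 set_itv1 !Rintegral_set1.
  have E : p + k.+1%:R * L = (p + k%:R * L) + L by rewrite -natr1; ring.
  have h1 : p <= p + k%:R * L by rewrite lerDl mulr_ge0 // ltW.
  have h2 : p + k%:R * L <= p + k%:R * L + L by rewrite lerDl ltW.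
  by rewrite E !(Rintegral_itv_split _ h1 h2) // lerD.
pose I n : set R := `[- (n%:R * L), n%:R * L]%classic.
have mI n : measurable (I n) by exact: measurable_itv.
have lim f : itg f -> \int[mu]_(x in I n) f x @[n --> \oo] --> \int[mu]_x f x.
  move=> i; have -> : (fun n => \int[mu]_(x in I n) f x) = (fun n => \int[mu]_x (f \_ (I n)) x).
    by apply/funext => n; rewrite Rintegral_mkcond.
  have [] := @Ritg_dominated R (fun n => f \_ (I n)) f (fun x => `|f x|) => //.
  - by move=> n; apply/(measurable_restrictT _ _).1 => //; apply: measurable_funTS; exact: itg_measurable.
  - move=> x; apply: cvg_near_cst; have := @nbhs_infty_ger R (`|x| / L).
    apply: filterS => n; rewrite ler_pdivrMr // => h.
    by rewrite patchE ifT // inE /I /= in_itv /= -ler_norml.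
  - exact: itg_abs.
  - by move=> n x; rewrite patchE; case: ifP; rewrite ?normr0.
have cF := lim _ iF; have cG := lim _ iG.
rewrite -(cvg_lim (@Rhausdorff R) cF) -(cvg_lim (@Rhausdorff R) cG).
apply: ler_lim; [by apply/cvg_ex; eexists; exact: cF|by apply/cvg_ex; eexists; exact: cG|].
apply: nearW => n; have := step (2 * n)%N (- (n%:R * L)).
by rewrite (_ : - (n%:R * L) + (2 * n)%:R * L = n%:R * L) // natrM; ring.
Qed.

End SumIntervals.

(** * Derivatives of cosine and sine transforms *)

Section BandLimited.
Context {R : realType}.
Local Notation mu := (@lebesgue_measure R).
Local Notation re := (@complex.Re R).
Local Notation im := (@complex.Im R).

Lemma is_derive_costr (a : R -> R) (x : R) : itg a -> itg (fun y => 2 * pi * y * a y) ->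
  is_derive x 1 (costr a) (- sintr (fun y => 2 * pi * y * a y) x).
Proof.
move=> ia ia'.
pose f (x y : R) := a y * cos (2 * pi * y * x).
have df (z y : R) : is_derive z 1 (f ^~ y) (- (2 * pi * y * a y * sin (2 * pi * y * z))).
  by rewrite /f; apply: is_derive_eq; rewrite /GRing.scale /=; ring.
have d1 (z y : R) : 'D_1 (f ^~ y) z = - (2 * pi * y * a y * sin (2 * pi * y * z)).
  by have [_ ->] := df z y.
have h := @cvg_differentiation_under_integral R _ _ mu f setT measurableT x (x - 1) (x + 1) _ _ _ (fun y => `|2 * pi * y * a y|) _ _ _.
have {h} h : h^-1 *: (costr a (h + x) - costr a x) @[h --> 0^'] --> - sintr (fun y => 2 * pi * y * a y) x.
  have -> : - sintr (fun y => 2 * pi * y * a y) x = \int[mu]_(y in setT) partial1of2 f x y.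
    rewrite -mulN1r -RitgZ; last exact: itg_sin.
    by apply: eq_Rintegral => y _; rewrite partial1of2E d1 mulN1r.
  apply: h.
  - by rewrite /= in_itv /=; apply/andP; split; lra.
  - by move=> z _; exact: itg_cos.
  - by move=> z y _ _; have [] := df z y.
  - by move=> y; exact: normr_ge0.
  - exact: itg_abs.
  - by move=> z y _ _; rewrite partial1of2E d1 normrN normrM ler_piMr // sin_max.
apply: DeriveDef.
  by apply/cvg_ex; eexists; under eq_fun do rewrite /GRing.scale /= mulr1; exact: h.
by apply/cvg_lim => //; under eq_fun do rewrite /GRing.scale /= mulr1; exact: h.
Qed.

Lemma is_derive_sintr (a : R -> R) (x : R) : itg a -> itg (fun y => 2 * pi * y * a y) ->
  is_derive x 1 (sintr a) (costr (fun y => 2 * pi * y * a y) x).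
Proof.
move=> ia ia'.
pose f (x y : R) := a y * sin (2 * pi * y * x).
have df (z y : R) : is_derive z 1 (f ^~ y) (2 * pi * y * a y * cos (2 * pi * y * z)).
  by rewrite /f; apply: is_derive_eq; rewrite /GRing.scale /=; ring.
have d1 (z y : R) : 'D_1 (f ^~ y) z = 2 * pi * y * a y * cos (2 * pi * y * z).
  by have [_ ->] := df z y.
have h := @cvg_differentiation_under_integral R _ _ mu f setT measurableT x (x - 1) (x + 1) _ _ _ (fun y => `|2 * pi * y * a y|) _ _ _.
have {h} h : h^-1 *: (sintr a (h + x) - sintr a x) @[h --> 0^'] --> costr (fun y => 2 * pi * y * a y) x.
  have -> : costr (fun y => 2 * pi * y * a y) x = \int[mu]_(y in setT) partial1of2 f x y.
    by apply: eq_Rintegral => y _; rewrite partial1of2E d1.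
  apply: h.
  - by rewrite /= in_itv /=; apply/andP; split; lra.
  - by move=> z _; exact: itg_sin.
  - by move=> z y _ _; have [] := df z y.
  - by move=> y; exact: normr_ge0.
  - exact: itg_abs.
  - by move=> z y _ _; rewrite partial1of2E d1 normrM ler_piMr // cos_max.
apply: DeriveDef.
  by apply/cvg_ex; eexists; under eq_fun do rewrite /GRing.scale /= mulr1; exact: h.
by apply/cvg_lim => //; under eq_fun do rewrite /GRing.scale /= mulr1; exact: h.
Qed.

End BandLimited.

(** * The interpolation estimate on the line *)

Section GlobalEstimate.
Context {R : realType}.
Local Notation mu := (@lebesgue_measure R).

(** Both sides of [local_estimate] are integrals over the interval with coefficients independent of
    [p], so they add up without loss. *)
Lemma global_estimate (D : nat -> R -> R) (A : set R) n (g L : R) :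
  (forall k (z : R), is_derive z 1 (D k) (D k.+1 z)) -> (forall k, itg (fun x => D k x ^+ 2)) ->
  measurable A -> 0 < g -> 1 <= L ->
  (forall p, ((g * L)%:E <= mu (A `&` `[p, (p + L)%R]%classic))%E) ->
  \int[mu]_x (D 0%N x ^+ 2) <=
  4 * Lam n g ^+ 2 / g * \int[mu]_x (D 0%N x ^+ 2 * \1_A x) +
  2 * L * (L ^+ n.+1 / n.+1`!%:R) ^+ 2 *
    (2 * \int[mu]_x (D n.+1 x ^+ 2) + \int[mu]_x (D n.+2 x ^+ 2)).
Proof.
move=> dD iD mA g0 L1 thA.
have iA : itg (fun x => D 0%N x ^+ 2 * \1_A x).
  apply: (itgM (M := 1) (iD 0%N)); first exact: measurable_indic.
  by move=> x; rewrite indicE; case: (x \in A); rewrite ?normr1 ?normr0.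
have iN : itg (fun x => 2 * D n.+1 x ^+ 2 + D n.+2 x ^+ 2).
  by apply: itgD => //; exact: itgZ.
rewrite -(RitgZ _ (iD n.+1)) -RitgD //; last exact: itgZ.
set c1 := 4 * Lam n g ^+ 2 / g; set c2 := 2 * L * _ ^+ 2.
rewrite -(RitgZ c1 iA) -(RitgZ c2 iN) -RitgD; [|exact: itgZ|exact: itgZ].
apply: (@sum_intervals _ _ _ L) => //.
- by apply: itgD; exact: itgZ.
- by rewrite (lt_le_trans _ L1).
move=> p; apply: le_trans (local_estimate n dD mA g0 L1 (thA p)) _.
have mI : measurable (`[p, (p + L)%R]%classic : set R) by exact: measurable_itv.
have iS f : itg f -> mu.-integrable `[p, (p + L)%R]%classic (EFin \o f).
  by move=> i; apply: integrableS i.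
rewrite RintegralD //; [|by apply: iS; exact: itgZ|by apply: iS; exact: itgZ].
rewrite !RintegralZl //; [|exact: iS|exact: iS].
rewrite lerD2r; apply: ler_wpM2l; first by apply: divr_ge0 (ltW g0); apply: mulr_ge0 => //; exact: sqr_ge0.
rewrite setIC Rintegral_mkcondr le_eqVlt; apply/orP; left; apply/eqP.
by apply: eq_Rintegral => x _; rewrite patchE indicE; case: (x \in A); rewrite ?mulr1 ?mulr0.
Qed.

End GlobalEstimate.

(** * Functions with spectrum in [-1, 1] *)

Section BandLimitedFunctions.
Context {R : realType}.
Local Notation mu := (@lebesgue_measure R).
Local Notation re := (@complex.Re R).
Local Notation im := (@complex.Im R).
Implicit Types (h f : R -> R[i]).

Lemma inLp2_sqr f : inLp 2%:E f ->
  itg (fun x => re (f x) ^+ 2) /\ itg (fun x => im (f x) ^+ 2).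
Proof.
by move=> [f1 f2]; split; [have := Lfun2_mul_Lfun1 f1 f1|have := Lfun2_mul_Lfun1 f2 f2];
  move=> /Lfun1_integrable; congr itg; apply/funext => x; rewrite expr2.
Qed.

Lemma pi_le4 : pi <= 4 :> R.
Proof. by have := @pihalf_lt2 R; lra. Qed.

Definition band h := inLp 2%:E h /\ forall x, 1 < `|x| -> h x = 0.

(** On the bounded support [|a| <= 1 + a^2]. Integrability turns the inverse transform into a
    genuine integral, which can be differentiated. *)
Lemma band_inLp1 h : band h -> inLp 1%:E h.
Proof.
move=> [h2 h0]; have [m1 m2] := inLp_measurable h2; have [i1 i2] := inLp2_sqr h2.
have key (a : R -> R) : measurable_fun setT a -> itg (fun x => a x ^+ 2) ->
    (forall x, 1 < `|x| -> a x = 0) -> itg a.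
  move=> ma ia a0; pose b x : R := \1_(`[-1, 1]%classic : set R) x.
  have b1 x : `|b x| <= 1 by rewrite /b indicE; case: (_ \in _); rewrite ?normr1 ?normr0.
  have bE x : `|x| <= 1 -> b x = 1.
    by move=> x1; rewrite /b indicE mem_set // /= in_itv /= -ler_norml.
  have b0 x : 1 < `|x| -> b x = 0.
    move=> x1; rewrite /b indicE memNset //= in_itv /= -ler_norml; apply/negP; by rewrite -ltNge.
  have ib : itg b.
    by apply: (itg_bounded_supp (K := 1) _ b1) => //; exact: measurable_indic.
  apply: (itg_le ma (itgD ib ia)) => x; case: (lerP `|x| 1) => x1.
    rewrite bE //; have := sqr_ge0 (`|a x| - 1); have := sqr_ge0 (`|a x|).
    have := real_normK (num_real (a x)); rewrite !expr2; move: (a x * a x) (`|a x|) => u v; lra.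
  by rewrite a0 // b0 // normr0 expr0n addr0.
by apply/inLp1P; split; apply: key => // x x1; rewrite /= h0.
Qed.

(* Multiplication by [2 i pi x], conjugate to [d/dx] by the inverse transform. *)
Definition mulD h (x : R) : R[i] :=
  Complex (- (2 * pi * x * im (h x))) (2 * pi * x * re (h x)).

(** Bernstein's inequality on the Fourier side: [2 pi |x| <= 8] on the spectrum, since [pi <= 4]. *)
Lemma band_mulD h : band h -> band (mulD h) /\ ip (mulD h) (mulD h) <= 64 * ip h h.
Proof.
move=> hb; have [h2 h0] := hb; have [m1 m2] := inLp_measurable h2; have [i1 i2] := inLp2_sqr h2.
have mx : measurable_fun setT (fun x : R => 2 * pi * x).
  by apply: continuous_measurable_fun; exact: continuous_linear.
have pw (a : R -> R) x : (1 < `|x| -> a x = 0) -> (2 * pi * x * a x) ^+ 2 <= 64 * a x ^+ 2.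
  move=> a0; case: (lerP `|x| 1) => x1; last by rewrite a0 // mulr0 expr0n mulr0.
  rewrite [leLHS]exprMn ler_wpM2r ?sqr_ge0 // -[leLHS]real_normK ?num_real //.
  rewrite [leRHS](_ : 64 = 8 ^+ 2); last by rewrite expr2 -natrM.
  rewrite lerXn2r ?nnegrE // !normrM (ger0_norm (pi_ge0 R)) normr_nat.
  apply: (@le_trans _ _ (2 * pi * 1)); first by rewrite ler_wpM2l // mulr_ge0 ?pi_ge0.
  by have := pi_le4; lra.
have isq (a : R -> R) : measurable_fun setT a -> itg (fun x => a x ^+ 2) ->
    (forall x, 1 < `|x| -> a x = 0) -> itg (fun x => (2 * pi * x * a x) ^+ 2).
  move=> ma ia a0; apply: (itg_le _ (itgZ 64 ia)).
    by apply: measurable_funX; apply: measurable_funM.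
  by move=> x; rewrite ger0_norm ?sqr_ge0 //; apply: pw; exact: a0.
have d2 : inLp 2%:E (mulD h).
  apply: inLp2_Complex.
  - by apply: measurableT_comp => //; apply: measurable_funM.
  - by apply: measurable_funM.
  - under eq_fun do rewrite sqrrN; apply: (isq (im \o h)) => // x x1; by rewrite /= h0.
  - by apply: (isq (re \o h)) => // x x1; rewrite /= h0.
split; first by split=> // x x1; rewrite /mulD h0 //= !mulr0 oppr0.
rewrite /ip -RitgZ; last exact: integrable_cdot.
apply: Ritg_le; [exact: integrable_cdot|apply: itgZ; exact: integrable_cdot|] => x.
rewrite /cdot /mulD /= -!expr2 sqrrN (mulrDr 64) addrC; apply: lerD.
  by apply: (pw (re \o h)) => x1; rewrite /= h0.
by apply: (pw (im \o h)) => x1; rewrite /= h0.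
Qed.

Lemma band_iter h k : band h -> band (iter k mulD h) /\
  ip (iter k mulD h) (iter k mulD h) <= 64 ^+ k * ip h h.
Proof.
move=> hb; elim: k => [|k [bk ik]]; first by rewrite expr0 mul1r.
have [b1 i1] := band_mulD bk; split => //; apply: (le_trans i1).
by rewrite exprS -mulrA ler_pM2l.
Qed.

Lemma costrNl (a : R -> R) x : itg a -> costr (fun y => - a y) x = - costr a x.
Proof.
move=> ia; rewrite /costr -[RHS]mulN1r -RitgZ; last exact: itg_cos.
by apply: eq_Rintegral => y _; rewrite mulNr mulN1r.
Qed.

Lemma sintrNl (a : R -> R) x : itg a -> sintr (fun y => - a y) x = - sintr a x.
Proof.
move=> ia; rewrite /sintr -[RHS]mulN1r -RitgZ; last exact: itg_sin.
by apply: eq_Rintegral => y _; rewrite mulNr mulN1r.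
Qed.

Lemma is_derive_FT h (x : R) : inLp 1%:E h -> inLp 1%:E (mulD h) ->
  is_derive x 1 (re \o FT (-1) h) (re (FT (-1) (mulD h) x)) /\
  is_derive x 1 (im \o FT (-1) h) (im (FT (-1) (mulD h) x)).
Proof.
move=> /inLp1P[i1 i2] /inLp1P[j2 j1].
have {}j2 : itg (fun y => 2 * pi * y * (im \o h) y).
  by have := itgZ (-1) j2; congr itg; apply/funext => y /=; rewrite mulN1r opprK.
have d1 := is_derive_costr x i1 j1; have d2 := is_derive_costr x i2 j2.
have d3 := is_derive_sintr x i1 j1; have d4 := is_derive_sintr x i2 j2.
rewrite /FT /=; split.
  have -> : re \o FT (-1) h = (fun y => costr (re \o h) y - sintr (im \o h) y).
    by apply/funext => y /=; rewrite mulN1r.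
  apply: is_derive_eq.
  have -> : re \o mulD h = (fun y => - (2 * pi * y * (im \o h) y)) by [].
  by rewrite costrNl // mulN1r addrC.
have -> : im \o FT (-1) h = (fun y => costr (im \o h) y + sintr (re \o h) y).
  by apply/funext => y /=; rewrite mulN1r opprK.
apply: is_derive_eq.
have -> : re \o mulD h = (fun y => - (2 * pi * y * (im \o h) y)) by [].
by rewrite sintrNl // mulN1r opprK addrC.
Qed.

Lemma nat_scale (a : R) : 1 < a -> exists n : nat, 128 * a <= n.+1%:R <= 129 * a.
Proof.
move=> a1; exists (Num.truncn (128 * a)).
have h0 : 0 <= 128 * a by lra.
have /andP[t1 t2] := truncn_itv h0.
rewrite -(natr1 (Num.truncn _)) in t2 *; apply/andP; split; lra.
Qed.

End BandLimitedFunctions.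

(** * The inequality for band-limited functions *)

Section LogvinenkoSereda.
Context {R : realType}.
Local Notation mu := (@lebesgue_measure R).
Local Notation re := (@complex.Re R).
Local Notation im := (@complex.Im R).
Implicit Types (h f : R -> R[i]).

(** With [N = n + 1], [2 P + Q <= (2 + 64) 64^N S]. By [err_bound] the derivative term is then at
    most [S / 2] and moves to the left, which doubles the coefficient [4] into the [8] of
    [Lam_bound]. *)
Lemma absorb_error n (g L S T P Q : R) : 0 < g -> g <= 1 -> 1 <= L -> 64 * L <= n.+1%:R ->
  0 <= S -> 0 <= T -> P <= 64 ^+ n.+1 * S -> Q <= 64 ^+ n.+2 * S ->
  S <= 4 * Lam n g ^+ 2 / g * T + 2 * L * (L ^+ n.+1 / n.+1`!%:R) ^+ 2 * (2 * P + Q) ->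
  S <= (32 / g) ^+ n.+1 ^+ 2 * T.
Proof.
move=> g0 g1 L1 Ln S0 T0 hP hQ; set k2 := 2 * L * (_ ^+ 2) => est.
have k20 : 0 <= k2 by rewrite /k2; apply: mulr_ge0 (sqr_ge0 _); lra.
have err : k2 * (2 * P + Q) <= 2^-1 * S.
  apply: (@le_trans _ _ (k2 * (66 * 64 ^+ n.+1 * S))).
    apply: ler_wpM2l => //; move: hQ; rewrite [64 ^+ n.+2]exprS.
    by move: (64 ^+ n.+1) hP => e *; lra.
  rewrite !mulrA; apply: ler_wpM2r => //.
  have n0 : (2 <= n.+1)%N by rewrite -(ler_nat R); lra.
  have L0 : 0 < L by lra.
  apply: le_trans (err_bound L0 n0 Ln).
  rewrite le_eqVlt; apply/orP; left; apply/eqP.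
  rewrite /k2 (_ : 64 ^+ n.+1 = (8 ^+ n.+1) ^+ 2); last by rewrite -exprM mulnC exprM expr2 -natrM.
  rewrite !exprMn; move: (L ^+ n.+1) (8 ^+ n.+1) => x y; ring.
apply: (@le_trans _ _ (8 * Lam n g ^+ 2 / g * T)).
  have -> : 8 * Lam n g ^+ 2 / g * T = 2 * (4 * Lam n g ^+ 2 / g * T) by ring.
  lra.
by apply: ler_wpM2r => //; exact: Lam_bound.
Qed.

Lemma logvinenko_sereda h (A : set R) (g a : R) : band h -> measurable A ->
  0 < g -> g <= 1 -> 1 < a -> thick g a A ->
  (((g / 129) `^ (129 * a) * nrm (FT (-1) h))%:E <= L2norm A (FT (-1) h))%E.
Proof.
move=> hb mA g0 g1 a1 thA.
have s1 : (-1 : R) ^+ 2 = 1 by rewrite sqrrN expr1n.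
(* [f k] is the [k]-th derivative of [f 0]. *)
pose hk k := iter k mulD h; pose f k := FT (-1) (hk k).
have hkb k : band (hk k) by have [] := band_iter k hb.
have f2 k : inLp 2%:E (f k).
  by apply: FT_inLp2 => //; [exact: band_inLp1 (hkb k)|have [] := hkb k].
have Sk k : ip (f k) (f k) <= 64 ^+ k * ip (f 0%N) (f 0%N).
  have E j : ip (f j) (f j) = ip (hk j) (hk j).
    rewrite -!nrm_sqr /f plancherel //; [exact: band_inLp1 (hkb j)|by have [] := hkb j].
  by rewrite !E; have [] := band_iter k hb.
have [n /andP[n1 n2]] := nat_scale a1.
(* An interval of length [2 a] starting at [p] is the window of radius [a] around [p + a] in the
   definition of [thick]. *)
pose L := 2 * a; have L1 : 1 <= L by rewrite /L; lra.
have thp (p : R) : ((g * L)%:E <= mu (A `&` `[p, (p + L)%R]%classic))%E.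
  have := thA (p + a); rewrite /L (_ : p + a - a = p) ?addrK // -addrA (_ : a + a = 2 * a); last by ring.
  by rewrite (_ : 2 * g * a = g * (2 * a)) //; ring.
have iff k := inLp2_sqr (f2 k).
(* The interpolation error rests on Rolle's theorem, hence on real values: real and imaginary parts
   are estimated separately and the squares added. *)
have eu := @global_estimate R (fun k => re \o f k) A n g L
  (fun k z => (is_derive_FT z (band_inLp1 (hkb k)) (band_inLp1 (hkb k.+1))).1) (fun k => (iff k).1) mA g0 L1 thp.
have ev := @global_estimate R (fun k => im \o f k) A n g L
  (fun k z => (is_derive_FT z (band_inLp1 (hkb k)) (band_inLp1 (hkb k.+1))).2) (fun k => (iff k).2) mA g0 L1 thp.
have ipE k : ip (f k) (f k) = \int[mu]_x ((re \o f k) x ^+ 2) + \int[mu]_x ((im \o f k) x ^+ 2).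
  rewrite /ip -RitgD; [|exact: (iff k).1|exact: (iff k).2].
  by apply: eq_Rintegral => x _; rewrite /cdot -!expr2.
have iA b : itg b -> itg (fun x => b x * \1_A x).
  move=> ib; apply: (itgM (M := 1) ib); first exact: measurable_indic.
  by move=> x; rewrite indicE; case: (x \in A); rewrite ?normr1 ?normr0.
pose SA := \int[mu]_x (cdot (f 0%N x) (f 0%N x) * \1_A x).
have SAE : SA = \int[mu]_x ((re \o f 0%N) x ^+ 2 * \1_A x) + \int[mu]_x ((im \o f 0%N) x ^+ 2 * \1_A x).
  rewrite /SA -RitgD; [|apply: iA; exact: (iff 0%N).1|apply: iA; exact: (iff 0%N).2].
  by apply: eq_Rintegral => x _; rewrite /cdot -!expr2 mulrDl.
have SA0 : 0 <= SA.
  by apply: Rintegral_ge0 => x _; rewrite mulr_ge0 ?cdot_ge0 // indicE ler0n.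
pose S := ip (f 0%N) (f 0%N); have S0 : 0 <= S by exact: ip_ge0.
have main : S <= (32 / g) ^+ n.+1 ^+ 2 * SA.
  apply: (@absorb_error n g L S SA (ip (f n.+1) (f n.+1)) (ip (f n.+2) (f n.+2))) => //.
  - by apply: le_trans n1; rewrite /L mulrA -natrM.
  - rewrite /S !ipE SAE; apply: (le_trans (lerD eu ev)).
    clear; move: (Lam _ _) (_ / _`!%:R) (\int[mu]_x _) (\int[mu]_x _) (\int[mu]_x _) (\int[mu]_x _) (\int[mu]_x _) (\int[mu]_x _) => *.
    rewrite le_eqVlt; apply/orP; left; apply/eqP; ring.
have SAn : L2norm A (f 0%N) = (Num.sqrt SA)%:E.
  rewrite L2normE integral_mkcond -powR12_sqrt // -poweR_EFin; congr (_ `^ _)%E.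
  rewrite EFin_Ritg; last by apply: iA; exact: integrable_cdot.
  apply: eq_integral => x _; rewrite patchE indicE; case: (x \in A); by rewrite ?mulr1 ?mulr0.
rewrite -/(f 0%N) SAn lee_fin.
have r0 : 0 <= 32 / g by rewrite divr_ge0 // ltW.
apply: (@le_trans _ _ ((g / 129) `^ (129 * a) * ((32 / g) ^+ n.+1 * Num.sqrt SA))).
  apply: ler_wpM2l; first exact: powR_ge0.
  apply: (@le_trans _ _ (Num.sqrt ((32 / g) ^+ n.+1 ^+ 2 * SA))); first exact: ler_wsqrtr.
  by rewrite sqrtrM ?sqr_ge0 // sqrtr_sqr ger0_norm // exprn_ge0.
rewrite mulrA -[leRHS]mul1r; apply: ler_wpM2r; first exact: sqrtr_ge0.
by apply: final_constant => //; exact: lt_trans a1.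
Qed.

End LogvinenkoSereda.

(** * The free Schroedinger equation *)

Section LebesgueMeasurableSets.
Context {R : realType}.
Local Notation mu := (@lebesgue_measure R).

Lemma ae_imply2 (P Q S : R -> Prop) : (forall x, P x -> Q x -> S x) ->
  {ae mu, forall x, P x} -> {ae mu, forall x, Q x} -> {ae mu, forall x, S x}.
Proof.
move=> PQS aP aQ; apply: negligibleS (negligibleU aP aQ) => x /= nS.
by apply/not_andP => -[Px Qx]; apply: nS; exact: PQS.
Qed.

Lemma le_lebesgue (A B : set R) : A `<=` B -> (mu A <= mu B)%E.
Proof. by move=> AB; exact: le_mu_ext. Qed.

(** The integral of a nonnegative function is a supremum over simple functions below its
    restriction, and enlarging the set enlarges that family. This covers sets that are only Lebesgue
    measurable. *)
Lemma ge0_integral_setS (A B : set R) (f : R -> \bar R) : A `<=` B ->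
  (forall x, 0 <= f x)%E -> (\int[mu]_(x in A) f x <= \int[mu]_(x in B) f x)%E.
Proof.
move=> AB f0; rewrite !ge0_integralE //; apply: le_ereal_sup => _ [h /= hA <-].
exists h => // x; apply: (le_trans (hA x)); rewrite !patchE.
case: ifPn => [xA|_]; last by case: ifP.
by rewrite ifT //; move: xA; rewrite !inE; exact: AB.
Qed.

Lemma L2norm_setS (A B : set R) (f : R -> R[i]) : A `<=` B -> (L2norm A f <= L2norm B f)%E.
Proof.
move=> AB; rewrite !L2normE; apply: gt0_ler_poweR => //.
- by rewrite in_itv /= leey andbT; apply: integral_ge0 => x _; rewrite lee_fin cdot_ge0.
- by rewrite in_itv /= leey andbT; apply: integral_ge0 => x _; rewrite lee_fin cdot_ge0.
- by apply: ge0_integral_setS => // x; rewrite lee_fin cdot_ge0.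
Qed.

(** [E] is a Borel set together with part of a null Borel set, and removing the null part preserves
    every lower bound on measures. *)
Lemma thick_Borel (g a : R) (E : set R) : lebesgue_measurable E -> thick g a E ->
  exists A : set R, [/\ measurable A, A `<=` E & thick g a A].
Proof.
case=> A mA [N [B [mB B0 NB]] <-] th; exists A; split=> // x.
have mI : measurable (`[(x - a)%R, (x + a)%R]%classic : set R) by exact: measurable_itv.
apply: (le_trans (th x)).
apply: (@le_trans _ _ (mu ((A `&` `[(x - a)%R, (x + a)%R]%classic) `|` B))).
  by apply: le_lebesgue => y [[Ay|/NB By] yI]; [left|right].
by rewrite -[leRHS]adde0 -B0; apply: measureU2 => //; exact: measurableI.
Qed.

(** Compare with the measure [2 a] of one window. This gives [8 / g >= 1] in [Lam_bound] and
    [g / 129 <= 1] in [final_constant]. *)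
Lemma thick_le1 (g a : R) (E : set R) : 0 < a -> thick g a E -> g <= 1.
Proof.
move=> a0 /(_ 0) th.
have : ((2 * g * a)%:E <= mu `[(0 - a)%R, (0 + a)%R]%classic)%E.
  by apply: (le_trans th); apply: le_lebesgue => x [].
rewrite mu_itv_cc; last by lra.
rewrite lee_fin => h; rewrite -(ler_pM2r a0); lra.
Qed.

End LebesgueMeasurableSets.

(** * Spectrum and norm along the evolution *)

Section Schrodinger.
Context {R : realType}.
Local Notation mu := (@lebesgue_measure R).
Local Notation re := (@complex.Re R).
Local Notation im := (@complex.Im R).
Implicit Types (f g h w : R -> R[i]) (v : R -> R -> R[i]).

Lemma cdot_cis (theta : R) (z : R[i]) : cdot (cis theta * z) (cis theta * z) = cdot z z.
Proof.
case: z => p q; rewrite /cdot /cis /=.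
rewrite [LHS](_ : _ = (cos theta ^+ 2 + sin theta ^+ 2) * (p * p + q * q)); last by ring.
by rewrite cos2Dsin2 mul1r.
Qed.

Lemma nrm_cis (theta : R -> R) w : nrm (fun x => cis (theta x) * w x) = nrm w.
Proof. by rewrite /nrm; congr Num.sqrt; apply: eq_Rintegral => x _; rewrite cdot_cis. Qed.

Lemma supported_ae S f g : {ae mu, forall x, f x = g x} -> supported_in S f -> supported_in S g.
Proof. by apply: ae_imply2 => x fg f0 /f0; rewrite fg. Qed.

Lemma supported_cis S (theta : R -> R) w : supported_in S w ->
  supported_in S (fun x => cis (theta x) * w x).
Proof. by apply: ae_imply => x w0 /w0 ->; rewrite mulr0. Qed.

(** [w0] and the transform inside [schrodinger_solution] may differ on a null set; [L2FT_unique]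
    carries the support over. The transform of [v t] is then read off from [L2FT_inverse]. *)
Lemma schrodinger_solution_fourier (v0 w0 : R -> R[i]) v (Sigma : set R) (t : R) : is_fourier v0 w0 -> supported_in Sigma w0 ->
  schrodinger_solution v0 v ->
  exists w, [/\ is_fourier (v t) w, supported_in Sigma w & nrm (v t) = nrm v0].
Proof.
move=> /is_fourierP F0 S0 [w1 /is_fourierP F1 /(_ t) /is_inv_fourierP I1].
have e1 : (1 : R) ^+ 2 = 1 by exact: expr1n.
have e2 : (-1 : R) ^+ 2 = 1 by rewrite sqrrN expr1n.
exists (fun xi => cis (- (pi * xi ^+ 2 * t)) * w1 xi); split.
- by apply/is_fourierP; have := L2FT_inverse e2 I1; rewrite opprK.
- by apply: supported_cis; exact: supported_ae (L2FT_unique e1 F0 F1) S0.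
- by rewrite (L2FT_isometry e2 I1) nrm_cis (L2FT_isometry e1 F1).
Qed.

(** Cutting [w] to zero everywhere outside the interval changes it on a null set. The inverse
    Fourier integral of the result is a smooth representative of [f], to which Rolle's theorem
    applies. *)
Lemma band_representative f w : is_fourier f w -> supported_in `[-1, 1]%classic w ->
  exists2 h, band h & {ae mu, forall x, f x = FT (-1) h x}.
Proof.
move=> /is_fourierP F S.
have e1 : (1 : R) ^+ 2 = 1 by exact: expr1n.
have e2 : (-1 : R) ^+ 2 = 1 by rewrite sqrrN expr1n.
have [_ w2 _] := F; have [m1 m2] := inLp_measurable w2; have [i1 i2] := inLp2_sqr w2.
pose b (x : R) : R := \1_(`[-1, 1]%classic : set R) x.
have mb : measurable_fun setT b by exact: measurable_indic.
pose h x : R[i] := Complex (re (w x) * b x) (im (w x) * b x).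
have b01 x : (b x == 0) || (b x == 1).
  by rewrite /b indicE; case: (_ \in _); rewrite /= eqxx ?orbT.
have bsq (a : R -> R) : measurable_fun setT a -> itg (fun x => a x ^+ 2) -> itg (fun x => (a x * b x) ^+ 2).
  move=> ma ia; apply: (itg_le _ ia); first by apply: measurable_funX; exact: measurable_funM.
  move=> x; rewrite ger0_norm ?sqr_ge0 // exprMn.
  by case/orP: (b01 x) => /eqP ->; rewrite ?expr1n ?mulr1 // expr0n mulr0 sqr_ge0.
have hb : band h.
  split.
    apply: inLp2_Complex; [exact: measurable_funM|exact: measurable_funM|by apply: (bsq (re \o w))|by apply: (bsq (im \o w))].
  move=> x x1; rewrite /h (_ : b x = 0) ?mulr0 // /b indicE memNset //= in_itv /= -ler_norml.
  by apply/negP; rewrite -ltNge.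
exists h => //; have h1 := band_inLp1 hb; have h2 : inLp 2%:E h by case: hb.
have wh : {ae mu, forall x, w x = h x}.
  apply: ae_imply S => x; rewrite /h /b indicE; case: (boolP (x \in _)) => [_ _|].
    by rewrite !mulr1; case: (w x).
  by rewrite notin_setE => xS /(_ xS) ->; rewrite !mulr0.
by have := L2FT_unique e2 (L2FT_ae (L2FT_inverse e1 F) h2 wh) (L2FT_FT e2 h1 h2).
Qed.

Lemma L2norm_ae (A : set R) f g : measurable A -> inLp 2%:E f -> inLp 2%:E g ->
  {ae mu, forall x, f x = g x} -> L2norm A f = L2norm A g.
Proof.
move=> mA f2 g2 fg; rewrite !L2normE; congr (_ `^ _)%E.
have m k : inLp 2%:E k -> measurable_fun A (EFin \o (fun x => cdot (k x) (k x))).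
  by move=> k2; apply: measurable_funTS; case/integrableP: (integrable_cdot k2 k2).
by apply: ae_eq_integral => //; [exact: m|exact: m|apply: ae_imply fg => x -> _].
Qed.

End Schrodinger.

Theorem mainTheorem4 (R : realType) :
  [/\ (* (1) *)
      forall (S Sigma : set R) (v0 w0 : R -> R[i]) (v : R -> R -> R[i]),
        lebesgue_measurable S -> lebesgue_measurable Sigma ->
        is_fourier v0 w0 -> supported_in Sigma w0 ->
        schrodinger_solution v0 v ->
        annihilating_pair S Sigma ->
        (exists2 t : R, 0 < t & supported_in S (v t)) ->
        {ae @lebesgue_measure R, forall x, v0 x = 0},
      (* (2) *)
      forall (S Sigma : set R) (v0 w0 : R -> R[i]) (v : R -> R -> R[i]) (D : R),
        lebesgue_measurable S -> lebesgue_measurable Sigma ->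
        is_fourier v0 w0 -> supported_in Sigma w0 ->
        schrodinger_solution v0 v ->
        strong_annihilating_pair_with S Sigma D ->
        forall t : R, 0 < t ->
          (L2norm (~` S) (v t) >= D%:E * L2norm setT (v t))%E /\
          (D%:E * L2norm setT (v t) = D%:E * L2norm setT v0)%E &
      (* (3) *)
      exists2 C : R, 0 < C &
        forall (v0 w0 : R -> R[i]) (v : R -> R -> R[i]) (E : set R) (gamma a : R),
          is_fourier v0 w0 -> supported_in `[-1, 1]%classic w0 ->
          schrodinger_solution v0 v ->
          lebesgue_measurable E -> 0 < gamma -> 1 < a -> thick gamma a E ->
          forall t : R, 0 < t ->
            (L2norm E (v t) >= ((gamma / C) `^ (C * a))%:E * L2norm setT v0)%E].
Proof.
have L2v0 (v0 w : R -> R[i]) : is_fourier v0 w -> inLp 2%:E v0 by case.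
split.
- move=> S Sigma v0 w0 v _ _ F0 S0 sol ann [t _ St].
  have [w [Ft Sw nv]] := schrodinger_solution_fourier t F0 S0 sol.
  have vt2 := L2v0 _ _ Ft; have v02 := L2v0 _ _ F0.
  apply: nrm_eq0_ae => //; rewrite -nv.
  have z2 : inLp 2%:E (fun=> 0 : R[i]).
    have := inLp2B vt2 vt2; congr inLp; apply/funext => x /=; exact: subrr.
  rewrite (nrm_ae vt2 z2); last exact: ann Ft St Sw.
  by rewrite /nrm /ip /Rintegral integral0_eq ?sqrtr0 // => x _; rewrite /cdot /= mul0r addr0.
- move=> S Sigma v0 w0 v D _ _ F0 S0 sol [_ ann] t _.
  have [w [Ft Sw nv]] := schrodinger_solution_fourier t F0 S0 sol.
  by split; [exact: ann Ft Sw|rewrite !L2normT ?nv //; [exact: L2v0 F0|exact: L2v0 Ft]].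
- exists 129 => // v0 w0 v E g a F0 S0 sol mE g0 a1 thE t _.
  have [w [Ft Sw nv]] := schrodinger_solution_fourier t F0 S0 sol.
  have vt2 := L2v0 _ _ Ft; have v02 := L2v0 _ _ F0.
  have [h hb vh] := band_representative Ft Sw.
  have h2 : inLp 2%:E (FT (-1) h).
    by apply: FT_inLp2; [rewrite sqrrN expr1n|exact: band_inLp1|case: hb].
  have a0 : 0 < a by lra.
  have [A [mA AE thA]] := thick_Borel mE thE.
  (* The lower bound is proved on the Borel part of [E], where the norm is at most that on [E];
     there [v t] may be replaced by its smooth representative. *)
  apply: le_trans (L2norm_setS _ AE).
  rewrite (L2norm_ae mA vt2 h2 vh) (L2normT v02) -nv (nrm_ae vt2 h2 vh) -EFinM.
  exact: logvinenko_sereda hb mA g0 (thick_le1 a0 thE) a1 thA.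
Qed.
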